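(* Let $n$ be a positive integer, let $f:\mathbb{R}_+\to\mathbb{R}_+$ be a function, and let $(X,d)$ be an (extended) metric space of Assouad-Nagata dimension at most $n$. If $\mathcal{F}$ is the class of the intersection graphs of $f$-space-filling families of subsets of $X$, then $\operatorname{asdim}(\mathcal{F})\le n+1$.
   Context: Families are multisets and may be finite or infinite. The intersection graph of a family $\mathcal{A}$ of sets is the (finite or infinite) simple graph with vertex set $\mathcal{A}$ in which two distinct vertices (members) $S_1,S_2$ are adjacent iff $S_1\cap S_2\neq\emptyset$. Metric spaces are extended: $d(x,y)=+\infty$ is allowed. $\operatorname{diam}(U)=\sup_{x,y\in U}d(x,y)$. For $r>0$ a collection $\mathcal{U}$ of subsets of $X$ is $r$-disjoint if $\inf_{u\in U,u'\in U'}d(u,u')>r$ for all distinct $U,U'\in\mathcal{U}$. For an integer $m\ge 0$, a function $g:\mathbb{R}_+\to\mathbb{R}_+$ is an $m$-dimensional control function for $(X,d)$ if for every real $r>0$ there is a cover $\mathcal{U}=\bigcup_{i=1}^{m+1}\mathcal{U}_i$ of $X$ with $\operatorname{diam}(U)\le g(r)$ for all $U\in\mathcal{U}$ and each $\mathcal{U}_i$ being $r$-disjoint. A dilation is a function $g(x)=cx$ for some constant $c>0$. The Assouad-Nagata dimension of $(X,d)$ is the least integer $m\ge 0$ such that some dilation is an $m$-dimensional control function for $(X,d)$ ($\infty$ if none exists). A graph $G$ is viewed as the extended metric space $(V(G),\operatorname{dist}_G)$, where $\operatorname{dist}_G(u,v)$ is the infimum of the number of edges of paths between $u$ and $v$.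 A class $\mathcal{G}$ of (finite or infinite) graphs has asymptotic dimension at most $m$ if some single function $g:\mathbb{R}_+\to\mathbb{R}_+$ is an $m$-dimensional control function for all graphs in $\mathcal{G}$; $\operatorname{asdim}(\mathcal{G})$ is the least such integer $m\ge 0$ ($\infty$ if none). For $f:\mathbb{R}_+\to\mathbb{R}_+$, a family $\mathcal{S}$ of subsets of $(X,d)$ is $f$-space-filling if every member of $\mathcal{S}$ has finite diameter, and for all real $r,s>0$ and all $x\in X$, the ball $B(x,r)=\{y\in X: d(x,y)\le r\}$ is intersected by at most $f(r/s)$ pairwise disjoint members of $\mathcal{S}$ of diameter at least $s$ (that is, any collection of pairwise disjoint members of $\mathcal{S}$, each of diameter at least $s$ and each meeting $B(x,r)$, has size at most $f(r/s)$). *)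

(* Defs.v *)
From mathcomp Require Import all_boot all_order all_algebra.
From mathcomp Require Import all_classical all_reals ereal.

Set Implicit Arguments.
Unset Strict Implicit.
Unset Printing Implicit Defensive.

Import Order.TTheory GRing.Theory Num.Theory.

Local Open Scope classical_set_scope.
Local Open Scope ring_scope.

(* Functions R_+ -> R_+ are encoded as functions R -> R that are nonnegative
   on nonnegative arguments. *)
Definition nonneg_fun (R : realType) (g : R -> R) : Prop :=
  forall x : R, 0 <= x -> 0 <= g x.

Section ExtendedMetric.
Variables (R : realType) (X : Type).
Implicit Types (d : X -> X -> \bar R) (A B : set X) (m : nat).

Definition extended_metric d : Prop :=
  [/\ forall x y, (0 <= d x y)%E,
      forall x y, d x y = 0%E <-> x = y,
      forall x y, d x y = d y x
    & forall x y z, (d x z <= d x y + d y z)%E].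

Definition closed_eball d (x : X) (r : R) : set X := [set y | (d x y <= r%:E)%E].

(* The supremum is taken in [0, +oo], so that the empty set has diameter 0
   (ereal_sup of the empty set is -oo). *)
Definition diam d A : \bar R :=
  maxe 0%:E (ereal_sup [set d x y | x in A & y in A]).

Definition r_disjoint d (r : R) (U : set (set X)) : Prop :=
  forall A B, U A -> U B -> A <> B ->
    (r%:E < ereal_inf [set d x y | x in A & y in B])%E.

Definition control_function d m (g : R -> R) : Prop :=
  nonneg_fun g /\
  forall r : R, 0 < r ->
    exists U : 'I_m.+1 -> set (set X),
      [/\ \bigcup_i \bigcup_(A in U i) A = setT,
          forall i A, U i A -> (diam d A <= (g r)%:E)%E
        & forall i, r_disjoint d r (U i)].

Definition dilation (g : R -> R) : Prop :=
  exists2 c : R, 0 < c & g = (fun x => c * x).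

(* The infimum of a set of naturals: its least element, or +oo if empty. *)
Definition assouad_nagata_dim d : \bar R :=
  ereal_inf [set (m%:R)%:E | m in
    [set m : nat | exists2 g, dilation g & control_function d m g]].

(* A family of subsets (a multiset) is an indexed family S : I -> set X; its
   members, counted with multiplicity, are the indices. *)
Definition space_filling d (f : R -> R) (I : Type) (S : I -> set X) : Prop :=
  (forall i, (diam d (S i) < +oo)%E) /\
  forall (r s : R) (x : X), 0 < r -> 0 < s ->
    forall J : set I,
      trivIset J S ->
      (forall i, J i -> (s%:E <= diam d (S i))%E) ->
      (forall i, J i -> S i `&` closed_eball d x r !=set0) ->
      exists2 k : nat, (J #= `I_k)%card & k%:R <= f (r / s).

End ExtendedMetric.

Record graph := Graph {
  vertex : Type;
  adj : vertex -> vertex -> Prop;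
  adj_sym : forall u v, adj u v -> adj v u;
  adj_irrefl : forall u, ~ adj u u }.

(* p 0, ..., p k are the successive, pairwise distinct, vertices of a path
   with k edges; the values of p beyond k are irrelevant. *)
Definition is_path (G : graph) (u v : vertex G) (k : nat)
    (p : nat -> vertex G) : Prop :=
  [/\ p 0%N = u, p k = v,
      forall i, (i < k)%N -> adj (p i) (p i.+1)
    & forall i j, (i <= k)%N -> (j <= k)%N -> p i = p j -> i = j].

Definition graph_dist (R : realType) (G : graph) (u v : vertex G) : \bar R :=
  ereal_inf [set (k%:R)%:E | k in [set k : nat | exists p, is_path u v k p]].

Definition asdim_at_most (R : realType) (C : set graph) (m : nat) : Prop :=
  exists g : R -> R, forall G, C G -> control_function (@graph_dist R G) m g.

Definition asdim (R : realType) (C : set graph) : \bar R :=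
  ereal_inf [set (m%:R)%:E | m in [set m : nat | asdim_at_most R C m]].

Section IntersectionGraph.
Variables (X I : Type) (S : I -> set X).

Definition meet_adj (i j : I) : Prop := i <> j /\ S i `&` S j !=set0.

Lemma meet_adj_sym i j : meet_adj i j -> meet_adj j i.
Proof. by move=> [ij Sij]; split; [exact: nesym | rewrite setIC]. Qed.

Lemma meet_adj_irrefl i : ~ meet_adj i i.
Proof. by case. Qed.

Definition intersection_graph : graph := Graph meet_adj_sym meet_adj_irrefl.

End IntersectionGraph.

Definition space_filling_graphs (R : realType) (X : Type)
    (d : X -> X -> \bar R) (f : R -> R) : set graph :=
  [set G | exists (I : Type) (S : I -> set X),
    space_filling d f S /\ G = intersection_graph S].

(* Main.v *)
Require Import Defs.
From mathcomp Require Import all_boot all_order all_algebra.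
From mathcomp Require Import all_classical all_reals ereal.
From mathcomp Require Import zify ring lra.

Set Implicit Arguments.
Unset Strict Implicit.
Unset Printing Implicit Defensive.

Import Order.TTheory GRing.Theory Num.Theory.

Local Open Scope classical_set_scope.
Local Open Scope ring_scope.

(** Each member of the family gets a level, the logarithm of its diameter, and
    each colour of the covers of X at the corresponding scales selects the
    members meeting a cell of that colour. Cells of one colour being far apart,
    a chain of selected members of level at most l stays close to one cell of
    level l, so these chains are the nodes of a rooted forest and the members of
    level at least l touching a node form a bag of a tree decomposition. Space
    filling bounds the number of pairwise disjoint members in a bag, and by
    induction on this number such a graph has a 2-colouring with bounded
    monochromatic components, i.e. asymptotic dimension at most 1. Treating the
    colours one after the other with decreasing distances, the second colour of
    the 2-colourings can be shared, so that m + 1 colours for X give m + 2 for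
    the graph. An ultrafilter limit extends the colouring from the finite
    subfamilies to the whole family. *)

(** * Walks, chains and independence *)

(* Adjacency relations are symmetric, and reflexive only on their support
   [E x x]; passing to a set of vertices is passing to a smaller relation. *)
Definition adjacency (V : Type) (E : V -> V -> Prop) : Prop :=
  (forall x y, E x y -> E y x) /\ (forall x y, E x y -> E x x).

(** Vertices of the support carry loops, so walks may idle and this is the relation of being at
    distance at most [k]. *)
Fixpoint walk (V : Type) (E : V -> V -> Prop) (k : nat) (x y : V) : Prop :=
  if k is k'.+1 then exists2 z, walk E k' x z & E z y else x = y /\ E x x.

Inductive chain (V : Type) (Q : V -> Prop) (E : V -> V -> Prop) (x : V) :
    V -> Prop :=
| chain0 : Q x -> E x x -> chain Q E x x
| chainS y z : chain Q E x y -> E y z -> Q z -> chain Q E x z.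

(** Sequences of pairwise non-adjacent terms of [B] have length at most [K]. The recursive form,
    deleting a vertex with its neighbours, suits inductions on [K]. *)
Fixpoint thin (V : Type) (E : V -> V -> Prop) (K : nat) (B : V -> Prop) : Prop :=
  if K is k.+1 then forall b, B b -> thin E k (fun x => B x /\ ~ E b x)
  else forall b, ~ B b.

(** A bound on weak diameters of components: the walks in [e] may leave [Q]. *)
Definition chains_bounded (V : Type) (e E : V -> V -> Prop) (Q : V -> Prop)
    (D : nat) : Prop :=
  forall x y, chain Q E x y -> walk e D x y.

Section Walks.
Variables (V : Type) (E : V -> V -> Prop).
Hypothesis adjE : adjacency E.

Lemma adjC x y : E x y -> E y x. Proof. exact: adjE.1. Qed.
Lemma adjl x y : E x y -> E x x. Proof. exact: adjE.2. Qed.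
Lemma adjr x y : E x y -> E y y. Proof. by move=> /adjC/adjl. Qed.

Lemma walkr k x y : walk E k x y -> E y y.
Proof. by case: k => [[<-]//|k [z _ /adjr]]. Qed.

Lemma walkl k x y : walk E k x y -> E x x.
Proof. by elim: k y => [y []//|k IH y [z /IH]]. Qed.

Lemma walkxx k x : E x x -> walk E k x x.
Proof. by move=> xx; elim: k => [|k IH]; [split|exists x]. Qed.

Lemma walkS k x y : walk E k x y -> walk E k.+1 x y.
Proof. by move=> w; exists y => //; exact: walkr w. Qed.

Lemma walkW k k' x y : (k <= k')%N -> walk E k x y -> walk E k' x y.
Proof.
move=> /subnK <-; elim: (k' - k)%N => // n IH w.
by rewrite addSn; apply: walkS; exact: IH.
Qed.

Lemma walk1 x y : E x y -> walk E 1 x y.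
Proof. by move=> xy; exists x => //; split=> //; exact: adjl xy. Qed.

Lemma walk_trans k k' x y z :
  walk E k x y -> walk E k' y z -> walk E (k + k')%N x z.
Proof.
elim: k' z => [z w [<- _]|k' IH z w [u yu uz]]; first by rewrite addn0.
by rewrite addnS; exists u => //; exact: IH.
Qed.

Lemma walkC k x y : walk E k x y -> walk E k y x.
Proof.
elim: k y => [y [<-]//|k IH y [z /IH zx /adjC yz]].
by rewrite -add1n; apply: walk_trans zx; exact: walk1.
Qed.

Lemma walk_adj k : adjacency (walk E k).
Proof. by split=> x y; [exact: walkC|move=> /walkl /walkxx]. Qed.

(** With [j = j'], proximity at an odd radius becomes an edge between two balls. *)
Lemma walk_half j j' x y : walk E (j + j').+1 x y ->
  exists u v, [/\ walk E j x u, E u v & walk E j' v y].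
Proof.
elim: j' y => [|j' IH] y.
  rewrite addn0 => -[z xz zy]; exists z, y; split=> //.
  by split=> //; exact: adjr zy.
rewrite addnS => -[z /IH [u [v [xu uv vz]]] zy]; exists u, v; split=> //.
by exists z.
Qed.

Lemma walk_iter k n x y : walk (walk E k) n x y -> walk E (n * k)%N x y.
Proof.
elim: n y => [y [<- /walkl xx]|n IH y [z /IH xz zy]]; first exact: walkxx.
by rewrite mulSn addnC; exact: walk_trans xz zy.
Qed.

End Walks.

Lemma walk_sub (V : Type) (E E' : V -> V -> Prop) k x y :
  (forall x y, E x y -> E' x y) -> walk E k x y -> walk E' k x y.
Proof.
move=> EE'; elim: k y => [y [<- /EE']//|k IH y [z /IH xz /EE' zy]].
by exists z.
Qed.

Section Chains.
Variables (V : Type).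
Implicit Types (E H : V -> V -> Prop) (Q A B : V -> Prop).

Lemma chainl Q E x y : chain Q E x y -> Q x.
Proof. by elim. Qed.

Lemma chainr Q E x y : chain Q E x y -> Q y.
Proof. by case. Qed.

Lemma chain_adjl Q E x y : chain Q E x y -> E x x.
Proof. by elim. Qed.

Lemma chain_adjr Q E x y : adjacency E -> chain Q E x y -> E y y.
Proof. by move=> aE; case=> // z u _ /(adjr aE). Qed.

Lemma chain_sub Q E Q' E' x y :
    (forall z, Q z -> Q' z) ->
    (forall y z, Q y -> Q z -> E y z -> E' y z) ->
  chain Q E x y -> chain Q' E' x y.
Proof.
move=> QQ EE; elim=> [Qx xx|u v c IH uv Qv].
  by apply: chain0; [exact: QQ|exact: EE].
by apply: (chainS IH _ _); [apply: EE => //; exact: chainr c|exact: QQ].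
Qed.

Lemma chain_trans Q E x y z : chain Q E x y -> chain Q E y z -> chain Q E x z.
Proof. by move=> xy; elim=> // u v _ IH; exact: chainS IH. Qed.

Lemma chainC Q E x y : adjacency E -> chain Q E x y -> chain Q E y x.
Proof.
move=> aE; elim=> [|u v c IH uv Qv]; first exact: chain0.
apply: (chain_trans _ IH); apply: (@chainS _ _ _ _ v).
- by apply: chain0 => //; exact: adjr uv.
- exact: adjC.
- exact: chainr c.
Qed.

Lemma chain_ind_all Q E (T : V -> Prop) x :
    T x -> (forall y z, T y -> Q y -> Q z -> E y z -> T z) ->
  forall y, chain Q E x y -> T y.
Proof.
move=> Tx TS y; elim=> // u v c IH uv Qv.
by apply: (TS _ _ IH _ Qv uv); exact: chainr c.
Qed.

Lemma chain_prefix Q E x y :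
  chain Q E x y -> chain (fun z => chain Q E x z) E x y.
Proof.
elim=> [Qx xx|u v c IH uv Qv]; first by apply: chain0 => //; exact: chain0.
by apply: (chainS IH uv _); exact: chainS c uv Qv.
Qed.

(** Induction along the chain; [z] moves to the end each time the chain returns to [A]. *)
Lemma chain_last_exit Q E A x y : adjacency E -> chain Q E x y ->
  chain (fun z => Q z /\ ~ A z) E x y \/
  exists z, [/\ A z, chain Q E x z & z = y \/
    exists2 z', E z z' & chain (fun z => Q z /\ ~ A z) E z' y].
Proof.
move=> aE; elim=> [Qx xx|u v c IH uv Qv].
  have [Ax|nAx] := pselect (A x); last by left; exact: chain0.
  by right; exists x; split=> //; [exact: chain0|left].
have [Av|nAv] := pselect (A v).
  by right; exists v; split=> //; [exact: chainS c uv Qv|left].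
case: IH => [IH|[z [Az xz [zu|[z' zz' z'u]]]]].
- by left; exact: (chainS IH uv).
- right; exists z; split=> //; right; exists v; rewrite ?zu //.
  by apply: chain0 => //; exact: adjr uv.
- by right; exists z; split=> //; right; exists z' => //; exact: chainS z'u uv _.
Qed.

End Chains.

Lemma walk_chain (V : Type) (E : V -> V -> Prop) k x y :
  adjacency E -> walk E k x y -> chain (walk E k x) E x y.
Proof.
move=> aE; elim: k y => [y [<- xx]|k IH y xy]; first exact: chain0.
have [z /IH xz zy] := xy; apply: (chainS _ zy xy).
by apply: chain_sub xz => // u; exact: walkS.
Qed.

(** * Independence bounds and the extent of chains *)

Section Thin.
Variables (V : Type).
Implicit Types (E H : V -> V -> Prop) (Q A B : V -> Prop).

(** Non-adjacent members of [B'] have non-adjacent representatives in [B], so independent sequences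
    are carried over; [S] need not be a function. *)
Lemma thin_map (U : Type) E (E' : U -> U -> Prop) (S : U -> V -> Prop) K B
    (B' : U -> Prop) :
    (forall w, B' w -> exists2 u, B u & S w u) ->
    (forall w1 w2 u1 u2, S w1 u1 -> S w2 u2 -> E u1 u2 -> E' w1 w2) ->
  thin E K B -> thin E' K B'.
Proof.
move=> + SE; elim: K B B' => [|K IH] B B' BB /= tB w B'w.
  by have [u /tB] := BB _ B'w.
have [u Bu wu] := BB _ B'w; apply: IH (tB u Bu) => w' [B'w' nww'].
by have [u' Bu' w'u'] := BB _ B'w'; exists u' => //; split=> // /(SE _ _ _ _ wu w'u').
Qed.

Lemma thin_sub E K B B' : (forall w, B' w -> B w) -> thin E K B -> thin E K B'.
Proof.
move=> BB; apply: (@thin_map _ _ _ (fun w u => w = u)) => [w /BB|]; first by exists w.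
by move=> ? ? ? ? -> ->.
Qed.

Lemma thin_inh E K B : (forall b, B b -> thin E K B) -> thin E K B.
Proof.
move=> tB; have [[b /tB]//|nB] := pselect (exists b, B b).
by case: K {tB} => [|K] /= b Bb; case: nB; exists b.
Qed.

Lemma thinS E K B : thin E K B -> thin E K.+1 B.
Proof.
elim: K B => [|K IH] B tB b Bb; first by case: (tB b Bb).
by apply: IH; exact: tB.
Qed.

Lemma thin_empty E K B : (forall v, ~ B v) -> thin E K B.
Proof. by move=> B0; apply: thin_inh => b /B0. Qed.

(* Greedy covering: the part of the chain after its last visit near [u] only
   sees [B] outside the neighbourhood of [u], which is thinner. *)
Lemma thin_chain_bounded E H K B Q r t :
    adjacency E -> adjacency H -> (forall x y, H x y -> walk E t x y) ->
    thin E K B -> (forall z, Q z -> exists2 u, B u & walk E r z u) ->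
  chains_bounded E H Q (K * (r + r.+1 + t)).
Proof.
move=> aE aH HE; elim: K B Q => [|K IH] B Q tB QB x y xy.
  by have [u /tB] := QB _ (chainl xy).
have [u Bu xu] := QB _ (chainl xy).
(* [A] collects the vertices served by a neighbour of [u] in [B], all within [r + r.+1] of [x]. One
   step of [H], of length [t], then leads to a remainder covered by a thinner set. *)
pose A z := exists2 u', B u' /\ E u u' & walk E r z u'.
have uu : E u u := walkr aE xu.
have Adist z : A z -> walk E (r + r.+1) x z.
  move=> [u' [_ uu'] zu']; apply: walk_trans xu _.
  by rewrite -add1n; apply: walk_trans (walkC aE zu'); exact: walk1.
have [xA|[z [Az xz]]] := chain_last_exit A aH xy.
  by have [_ []] := chainl xA; exists u.
case=> [<-|[z' zz' z'y]].
  by apply: walkW (Adist _ Az) => //; rewrite mulSn -!addnA !leq_add2l; lia.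
rewrite mulSn; apply: walk_trans (IH _ _ (tB u Bu) _ _ _ z'y) => //.
  by apply: walk_trans (Adist _ Az) _; exact: HE.
move=> v [/QB[u' Bu' vu'] nAv]; exists u' => //; split=> // uu'.
by apply: nAv; exists u'.
Qed.

(* Contracts the maximal runs of a chain in [A]. *)
Lemma chain_absorb E H A N x y : adjacency E ->
    (forall b z, N b -> N z -> E b z -> H b z) ->
    (forall b b' z' z, N b -> E b b' -> chain A E b' z' -> E z' z -> N z ->
      H b z) ->
  chain (fun z => A z \/ N z) E x y ->
  chain A E x y \/ exists a b,
    [/\ x = a \/ (exists2 x', chain A E x x' & E x' a),
        chain N H a b
      & b = y \/ (exists2 y', E b y' & chain A E y' y)].
Proof.
move=> aE HN HA; elim=> [[Ax|Nx] xx|u v c IH uv AN].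
- by left; exact: chain0.
- right; exists x, x; split; [by left| |by left].
  by apply: chain0 => //; exact: HN.
have vv : E v v := adjr aE uv.
case: IH => [xu|[a [b [xa ab [bu|[y' by' y'u]]]]]].
- case: AN => [Av|Nv]; first by left; exact: chainS xu uv Av.
  right; exists v, v; split; [by right; exists u| |by left].
  by apply: chain0 => //; exact: HN.
- subst u; right; case: AN => [Av|Nv].
    by exists a, b; split=> //; right; exists v => //; exact: chain0.
  exists a, v; split; [by []| |by left].
  by apply: (chainS ab _ Nv); apply: HN => //; exact: chainr ab.
- right; case: AN => [Av|Nv].
    by exists a, b; split=> //; right; exists y' => //; exact: chainS y'u uv Av.
  exists a, v; split; [by []| |by left].
  by apply: (chainS ab _ Nv); apply: HA by' y'u uv Nv; exact: chainr ab.
Qed.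

End Thin.

(** * Tree-like graphs *)

(* The components of the sets [lev <= l] are the nodes of a rooted forest, and
   the bags [bag l v] form a tree decomposition of [E] indexed by them. *)
Section Levels.
Variables (V : Type) (E : V -> V -> Prop) (lev : V -> nat).

Definition conn (l : nat) : V -> V -> Prop := chain (fun x => lev x <= l)%N E.

Definition bag (l : nat) (v w : V) : Prop :=
  (l <= lev w)%N /\ exists2 u, conn l v u & E u w.

Definition tree_like (K : nat) : Prop := forall l v, thin E K (bag l v).

Hypothesis adjE : adjacency E.

Lemma connW l l' x y : (l <= l')%N -> conn l x y -> conn l' x y.
Proof. by move=> ll'; apply: chain_sub => // z zl; exact: leq_trans ll'. Qed.

Lemma conn_bag l v w : conn l v w -> bag l v = bag l w.
Proof.
move=> vw; apply/funext => x; apply/propext.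
split=> -[lx [u vu ux]]; split=> //; exists u => //.
  exact: chain_trans (chainC adjE vw) vu.
exact: chain_trans vw vu.
Qed.

Lemma conn_next l v u w : conn l v u -> E u w -> conn l v w \/ bag l v w.
Proof.
move=> vu uw; have [lw|lw] := leqP (lev w) l; first by left; exact: chainS vu uw _.
by right; split; [exact: ltnW|exists u].
Qed.

(** The chain stays in the node until it first meets the bag; an end of level at least [l] still in
    the node belongs to the bag. *)
Lemma conn_hit (Q : V -> Prop) l v u x y : conn l v u -> E u x ->
    chain Q E x y -> (l <= lev y)%N ->
  exists2 w, Q w & bag l v w.
Proof.
move=> vu ux xy ly.
suff: conn l v y \/ exists2 w, Q w & bag l v w.
  case=> // vy; exists y; first exact: chainr xy.
  by split=> //; exists y => //; exact: chain_adjr vy.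
elim: xy {ly} => [Qx xx|z z' xz IH zz' Qz'].
  by have [|vx] := conn_next vu ux; [left|right; exists x].
case: IH => [vz|]; last by right.
by have [|vz'] := conn_next vz zz'; [left|right; exists z'].
Qed.

End Levels.

(** * Tree decompositions after merging connected sets *)

Section Merge.
Variables (V : Type) (E : V -> V -> Prop) (lev : V -> nat) (Lm : nat).
Variables (M : V -> V -> Prop) (E' : V -> V -> Prop).

Definition max_lev (v : V) : nat :=
  (\max_(i < Lm.+1 | `[< exists2 x, M v x & lev x = i >]) i)%N.

Hypotheses (adjE : adjacency E) (adjE' : adjacency E').
Hypothesis levE : forall x, E x x -> (lev x <= Lm)%N.
Hypothesis Mconn : forall v x, M v x -> chain (M v) E v x.
Hypothesis E'M : forall v w, E' v w -> exists x y, [/\ M v x, M w y & E x y].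

Lemma lev_max_lev v x : M v x -> (lev x <= max_lev v)%N.
Proof.
move=> vx; have lx : (lev x < Lm.+1)%N.
  by rewrite ltnS; apply: levE; exact: chain_adjr (Mconn vx).
by apply: (leq_bigmax_cond (Ordinal lx)); apply/asboolP; exists x.
Qed.

Lemma max_lev_attained v : E' v v -> exists2 x, M v x & lev x = max_lev v.
Proof.
move=> /E'M[x [_ [vx _ _]]]; have lx : (lev x < Lm.+1)%N.
  by rewrite ltnS; apply: levE; exact: chain_adjr (Mconn vx).
have [|i /asboolP] := @eq_bigmax_cond _
  [pred i : 'I_Lm.+1 | `[< exists2 x, M v x & lev x = i >]] (fun i => i : nat).
  by apply/card_gt0P; exists (Ordinal lx); apply/asboolP; exists x.
by rewrite /max_lev => -[y vy yi] ->; exists y.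
Qed.

Lemma max_lev_le v : (max_lev v <= Lm)%N.
Proof. by apply/bigmax_leqP => i _; rewrite -ltnS. Qed.

Lemma merge_conn l v u x : conn E' max_lev l v u -> M u x -> conn E lev l v x.
Proof.
have sub w y : (max_lev w <= l)%N -> M w y -> conn E lev l w y.
  by move=> wl /Mconn; apply: chain_sub => // z /lev_max_lev/leq_trans; exact.
move=> vu; move: vu x; elim=> [vl _ x|w w' c IH ww' w'l x w'x]; first exact: sub.
have [z [z' [wz w'z' zz']]] := E'M ww'; have /(IH _) vz := wz.
have vz' : conn E lev l v z'.
  by apply: (chainS vz zz'); exact: leq_trans (lev_max_lev w'z') w'l.
apply: chain_trans vz' _; apply: chain_trans (sub _ _ w'l w'x).
by apply: chainC => //; exact: sub.
Qed.

(** The connected set [M w] touches the node and attains the level [max_lev w], at least [l], so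
    [conn_hit] applies inside it. *)
Lemma merge_bag l v w : bag E' max_lev l v w ->
  exists2 w', M w w' & bag E lev l v w'.
Proof.
move=> [lw [u vu uw]]; have [x [y [ux wy xy]]] := E'M uw.
have [z wz zw] := max_lev_attained (adjr adjE' uw).
apply: (conn_hit adjE (merge_conn vu ux) xy (y := z)); last by rewrite zw.
by apply: chain_trans (Mconn wz); apply: chainC => //; exact: Mconn.
Qed.

Lemma merge_tree_like K : (forall v w x y, E' v v -> E' w w ->
    M v x -> M w y -> E x y -> E' v w) ->
  tree_like E lev K -> tree_like E' max_lev K.
Proof.
move=> ME' tE l v.
apply: (@thin_map _ _ E E' (fun w x => M w x /\ E' w w)) (tE l v) => [w vw|].
  have [w' ww' vw'] := merge_bag vw; exists w' => //; split=> //.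
  by case: vw => _ [u _ /(adjr adjE')].
by move=> w1 w2 u1 u2 [? ?] [? ?]; exact: ME'.
Qed.

End Merge.

(** * Subtrees of the forest and their root bags *)

Section Roots.
Variables (V : Type) (E : V -> V -> Prop) (lev : V -> nat) (Lm : nat).
Hypotheses (adjE : adjacency E) (levE : forall x, E x x -> (lev x <= Lm)%N).

Local Notation conn := (conn E lev).
Local Notation bag := (bag E lev).

Definition linked (l l' : nat) (v : V) : Prop :=
  exists w u, [/\ bag l v w, bag l' v u & walk E 2 w u].

Fixpoint root_rec (k : nat) (v : V) : nat :=
  if k is k'.+1 then
    if `[< linked (Lm - k) (root_rec k' v) v >] then root_rec k' v
    else (Lm - k)%N
  else Lm.

(* The nodes are divided from the top into subtrees: a node starts a new
   subtree as soon as its bag is at distance more than 2 from the bag of the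
   root of the current one. The node of [v] at level [l] lies in the subtree
   whose root has level [root_level l v]. *)
Definition root_level (l : nat) (v : V) : nat := root_rec (Lm - l) v.

Lemma root_levelE l v : (l < Lm)%N -> root_level l v =
  if `[< linked l (root_level l.+1 v) v >] then root_level l.+1 v else l.
Proof.
move=> lL; rewrite /root_level subnS.
have -> : (Lm - l = (Lm - l).-1.+1)%N by rewrite prednK // subn_gt0.
by rewrite /= prednK ?subn_gt0// subKn // ltnW.
Qed.

Lemma root_level_max v : root_level Lm v = Lm.
Proof. by rewrite /root_level subnn. Qed.

Lemma root_level_ge l v : (l <= Lm)%N -> (l <= root_level l v <= Lm)%N.
Proof.
move=> /subKn <-; elim: (Lm - l)%N => [|k IH].
  by rewrite subn0 root_level_max leqnn.
have [kL|Lk] := ltnP k Lm; last first.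
  have e : (Lm - k.+1 = Lm - k)%N by rewrite (eqP Lk) (eqP (leqW Lk)).
  by rewrite e.
have e : ((Lm - k.+1).+1 = Lm - k)%N by rewrite -subSn.
rewrite root_levelE ?e ?leq_subr//.
case: ifP => _; last by rewrite leqnn leq_subr.
by move: IH => /andP[kr ->]; rewrite andbT (leq_trans _ kr) // -e.
Qed.

Lemma root_level_same l l' v :
  (l <= l')%N -> (l' <= root_level l v)%N -> root_level l' v = root_level l v.
Proof.
move=> /subnK <-; elim: (l' - l)%N => [//|n IH]; rewrite addSn => nr.
rewrite -IH; last exact: ltnW.
have lr := IH (ltnW nr); have [nL|Ln] := ltnP (n + l) Lm; last first.
  have lL : (l <= Lm)%N.
    rewrite leqNgt; apply/negP => /ltnW; rewrite -subn_eq0 => /eqP e.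
    by move: nr; rewrite /root_level e /= => /leq_trans/(_ Ln); rewrite ltnn.
  by have := leq_trans nr (andP (root_level_ge v lL)).2; rewrite ltnNge Ln.
by move: lr; rewrite root_levelE //; case: ifP => // _ e; move: nr; rewrite -e ltnn.
Qed.

(** Descending induction on [l']: from level [l] on, [v] and [w] have the same nodes, hence the same
    bags and the same outcome of [linked]. *)
Lemma root_level_conn l l' v w :
  conn l v w -> (l <= l')%N -> root_level l' v = root_level l' w.
Proof.
move=> vw ll'; have [Ll|lL] := leqP Lm l'.
  by rewrite /root_level (eqP Ll).
move: ll'; rewrite -(subKn (ltnW lL)).
elim: (Lm - l')%N => [_|k IH lk]; first by rewrite subn0 !root_level_max.
have [kL|Lk] := ltnP k Lm; last first.
  have e : (Lm - k.+1 = Lm - k)%N by lia.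
  by rewrite e IH // -e.
have e : ((Lm - k.+1).+1 = Lm - k)%N by rewrite -subSn.
rewrite (@root_levelE _ v) ?(@root_levelE (Lm - k.+1) w) ?e ?leq_subr// IH; last by lia.
have /andP[rk _] := root_level_ge w (leq_subr k Lm).
rewrite /linked (conn_bag adjE (connW lk vw)) (conn_bag adjE (connW _ vw)) //.
by lia.
Qed.

(** A vertex belongs to the node of its own level; this is the level of the root of the subtree
    containing that node. *)
Definition top (v : V) : nat := root_level (lev v) v.

Definition root_bag (v : V) : V -> Prop := bag (top v) v.

Definition near (k : nat) (v : V) : Prop :=
  exists2 u, root_bag v u & walk E k v u.

Definition same_root (v w : V) : Prop := top v = top w /\ conn (top v) v w.

Lemma top_ge v : E v v -> (lev v <= top v <= Lm)%N.
Proof. by move=> /levE/root_level_ge; exact. Qed.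

Lemma conn_top v : E v v -> conn (top v) v v.
Proof. by move=> vv; apply: chain0 => //; case/andP: (top_ge vv). Qed.

Lemma same_rootxx v : E v v -> same_root v v.
Proof. by move=> vv; split=> //; exact: conn_top. Qed.

Lemma same_rootC v w : same_root v w -> same_root w v.
Proof. by move=> [e vw]; split; rewrite -e //; exact: chainC. Qed.

Lemma same_root_trans u v w : same_root u v -> same_root v w -> same_root u w.
Proof.
move=> [e uv] [e' vw]; split; first by rewrite e.
by apply: chain_trans uv _; rewrite e.
Qed.

Lemma same_root_bag v w : same_root v w -> root_bag v = root_bag w.
Proof. by move=> [e /(conn_bag adjE)]; rewrite /root_bag {2}e. Qed.

Lemma near_step k n v w : same_root v w -> walk E n v w -> near k w ->
  near (n + k) v.
Proof.
move=> vw E_vw [u wu ku]; exists u; first by rewrite (same_root_bag vw).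
exact: walk_trans E_vw ku.
Qed.

Lemma nearW k k' v : (k <= k')%N -> near k v -> near k' v.
Proof. by move=> kk [u vu ku]; exists u => //; exact: walkW ku. Qed.

Lemma root_level_top l v : E v v -> (lev v <= l <= top v)%N ->
  root_level l v = top v.
Proof. by move=> vv /andP[vl lv]; exact: root_level_same. Qed.

Lemma same_top v w : E v v -> E w w -> (top v <= top w)%N ->
  (lev w <= top v)%N -> conn (top v) v w -> same_root v w.
Proof.
move=> vv ww vw wv c; split=> //.
have /andP[lv _] := top_ge vv.
rewrite -(root_level_top (l := top v) vv) ?lv ?leqnn//.
by rewrite (root_level_conn c (leqnn _)) root_level_top // wv.
Qed.

(** A walk leaves the root node only through its bag, and meeting that bag within [k] steps would
    make [v] near. *)
Lemma walk_far k v w : walk E k v w -> ~ near k v ->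
  (lev w < top v)%N /\ conn (top v) v w.
Proof.
elim: k w => [w [<- vv]|k IH w [z vz zw]] nv.
  have lv : (lev v < top v)%N.
    have /andP[lv _] := top_ge vv; rewrite ltn_neqAle lv andbT.
    apply/eqP => e; case: nv; exists v => //.
    by split; [rewrite e|exists v => //; exact: conn_top].
  by split=> //; apply: conn_top.
have vv := walkl vz.
have nv' : ~ near k v by move=> /(nearW (leqnSn k)).
have [lz cz] := IH z vz nv'.
have [cw|bw] := conn_next cz zw; last by case: nv; exists w => //; exists z.
split=> //; rewrite ltnNge; apply/negP => lw; case: nv; exists w => //.
  by split=> //; exists z.
by exists z.
Qed.

Lemma walk_same_root k v w : walk E k v w -> ~ near k v -> ~ near k w ->
  same_root v w.
Proof.
move=> vw nv nw; have vv := walkl vw; have ww := walkr adjE vw.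
have [lw cw] := walk_far vw nv.
have [lv cv] := walk_far (walkC adjE vw) nw.
have [l|/ltnW l] := leqP (top v) (top w).
  by apply: same_top => //; exact: ltnW.
by apply/same_rootC/same_top => //; exact: ltnW.
Qed.

(** Seen from the end with the lower top, the edge either stays inside the root node or ends in the
    root bag. *)
Lemma step_same_root v w : E v w ->
  [\/ same_root v w, root_bag v w | root_bag w v].
Proof.
move=> vw; have vv := adjl adjE vw; have ww := adjr adjE vw.
have next x y : E x x -> E x y -> root_bag x y \/ conn (top x) x y.
  by move=> xx xy; have [] := conn_next (conn_top xx) xy; [right|left].
have [l|/ltnW l] := leqP (top v) (top w).
  have [|c] := next v w vv vw; first by constructor 2.
  by constructor 1; apply: same_top => //; exact: chainr c.
have [|c] := next w v ww (adjC adjE vw); first by constructor 3.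
by constructor 1; apply/same_rootC/same_top => //; exact: chainr c.
Qed.

Definition parent_root (v : V) : nat := root_level (top v).+1 v.

(** A root starts a new subtree because its bag is at distance more than 2 from the root bag of the
    parent subtree. A bag vertex of level above the root therefore lies in the parent subtree, far
    from the root bag there. *)
Lemma root_bag_cases v u : root_bag v u -> same_root v u \/
  [/\ top u = parent_root v, conn (parent_root v) v u & ~ near 2 u].
Proof.
move=> [lu [u' vu' u'u]]; have uu := adjr adjE u'u.
have := chain_adjl vu'; have := lu; rewrite leq_eqVlt => /predU1P[e vv|{}lu vv].
  left; have c : conn (top v) v u by apply: (chainS vu' u'u); rewrite -e.
  split=> //; rewrite -(root_level_top (l := top v) vv) ?leqnn ?andbT.
    by rewrite (root_level_conn c (leqnn _)) {1}e.
  by case/andP: (top_ge vv).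
right; have vL : (top v < Lm)%N := leq_trans lu (levE uu).
have /andP[lv _] := top_ge vv.
(* A link would have given this node the root of its parent, of level above [top v]. *)
have nl : ~ linked (top v) (parent_root v) v.
  have := root_level_top (l := top v) vv; rewrite lv leqnn => /(_ isT).
  rewrite root_levelE //; case: ifPn => [_ e|/asboolPn //].
  by have /andP[] := root_level_ge v vL; rewrite e ltnn.
have bu : bag (top v) v u by split; [exact: ltnW|exists u'].
(* At or above the level of the parent's root, [u] would lie in both bags and link them. *)
have lup : (lev u < parent_root v)%N.
  rewrite ltnNge; apply/negP => pu; apply: nl; exists u, u.
  split=> //; last exact: walkxx.
  split=> //; exists u' => //; apply: connW vu'.
  by apply: ltnW; case/andP: (root_level_ge v vL).
have cu : conn (lev u) v u.
  have vu2 : conn (lev u) v u' := connW (ltnW lu) vu'.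
  exact: (chainS vu2 u'u (leqnn _)).
have tu : top u = parent_root v.
  rewrite /top -(root_level_conn cu (leqnn _)).
  by apply: root_level_same => //; exact: ltnW.
have cp : conn (parent_root v) v u by apply: connW cu; exact: ltnW.
split=> // -[w uw w2]; apply: nl; exists u, w; split=> //.
by move: uw; rewrite /root_bag tu (conn_bag adjE cp).
Qed.

Lemma root_bag_near v u : near 2 u -> root_bag v u -> same_root v u.
Proof. by move=> nu /root_bag_cases[//|[]]. Qed.

(** A vertex of [root_bag v] in the subtree of [v] lies in its own root bag. Hence [x] and [y]
    belong to the parent subtree, common to [v] and [w]. *)
Lemma parent_same_root v w x y : same_root v w ->
    root_bag v x -> root_bag w y -> ~ near 0 x -> ~ near 0 y -> same_root x y.
Proof.
move=> vw vx wy nx ny; have [tvw cvw] := vw.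
have far u z : root_bag u z -> ~ near 0 z ->
    top z = parent_root u /\ conn (parent_root u) u z.
  move=> uz nz; case: (root_bag_cases uz) => [uz'|[]//]; case: nz.
  case: (uz) => _ [u' _ /(adjr adjE) zz].
  by exists z => //; rewrite -(same_root_bag uz').
have [tx cx] := far _ _ vx nx; have [ty cy] := far _ _ wy ny.
have pvw : parent_root v = parent_root w.
  by rewrite /parent_root -tvw; apply: root_level_conn cvw (leqnSn _).
split; rewrite tx; first by rewrite ty.
have tp : (top v <= parent_root v)%N.
  have [vL|Lv] := ltnP (top v) Lm.
    by rewrite /parent_root; case/andP: (root_level_ge v vL) => *; lia.
  have /andP[_ tL] := top_ge (chain_adjl cvw).
  by rewrite /parent_root /root_level (eqP (leqW Lv)).
apply: chain_trans (chainC adjE cx) _; apply: chain_trans (connW tp cvw) _.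
by rewrite pvw.
Qed.

Lemma root_chain_bounded K H Q r t x y : tree_like E lev K -> adjacency H ->
    (forall x y, H x y -> walk E t x y) -> chain Q H x y ->
    (forall z, chain Q H x z -> same_root x z /\ near r z) ->
  walk E (K * (r + r.+1 + t)) x y.
Proof.
move=> tE aH HE xy Qr.
apply: (thin_chain_bounded adjE aH HE (tE (top x) x) (Q := chain Q H x)).
  by move=> z /Qr[/same_root_bag xz [u zu uz]]; exists u => //; move: zu; rewrite -xz.
exact: chain_prefix.
Qed.

End Roots.

(** * Two-colouring of tree-like graphs *)

Section TwoColoring.
Variables (V : Type) (E : V -> V -> Prop) (lev : V -> nat) (Lm K : nat).
Hypotheses (adjE : adjacency E) (levE : forall x, E x x -> (lev x <= Lm)%N).
Hypothesis treeE : tree_like E lev K.+1.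

Local Notation near := (near E lev Lm).
Local Notation same_root := (same_root E lev Lm).
Local Notation root_bag := (root_bag E lev Lm).
Local Notation top := (top E lev Lm).

(** The bound of [root_chain_bounded] with [r = t = 1], for runs of vertices satisfying [near 1]. *)
Definition near_diam : nat := (K.+1 * (1 + 2 + 1))%N.

(** The two extra edges enter and leave such a run. *)
Definition hop : nat := near_diam.+2.

Definition far_radius : nat := (hop + hop).+1.

Definition far (v : V) : Prop := E v v /\ ~ near far_radius v.

Definition far_adj (v w : V) : Prop :=
  [/\ far v, far w & exists x y, [/\ walk E hop v x, walk E hop w y & E x y]].

Lemma far_adj_walk v w : far_adj v w -> walk E far_radius v w.
Proof.
move=> [_ _ [x [y [vx wy xy]]]]; rewrite /far_radius -addSn.
by apply: walk_trans (walkC adjE wy); exists x.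
Qed.

Lemma walk_far_adj v w : far v -> far w -> walk E far_radius v w -> far_adj v w.
Proof.
move=> fv fw /(walk_half adjE)[x [y [vx xy yw]]]; split=> //.
by exists x, y; split=> //; exact: walkC.
Qed.

Lemma far_adj_adjacency : adjacency far_adj.
Proof.
split=> v w.
  by move=> vw; have [fv fw _] := vw; apply: walk_far_adj => //; apply: walkC => //;
    exact: far_adj_walk.
by move=> [fv _ _]; apply: walk_far_adj => //; apply: walkxx => //; case: fv.
Qed.

Lemma far_adj_same_root v w : far_adj v w -> same_root v w.
Proof.
by move=> vw; have [[_ fv] [_ fw] _] := vw; exact: walk_same_root (far_adj_walk vw) fv fw.
Qed.

Let ball_lev := max_lev lev Lm (walk E hop).

Let ball_conn v x : walk E hop v x -> chain (walk E hop v) E v x.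
Proof. exact: walk_chain. Qed.

(* A node strictly inside the subtree of [v] has a vertex of its bag close to
   the root bag; being far from all far vertices, it lowers the bound. *)
Lemma far_tree_like : tree_like far_adj ball_lev K.
Proof.
have aE' := far_adj_adjacency.
have E'M v w : far_adj v w ->
  exists x y, [/\ walk E hop v x, walk E hop w y & E x y] by case.
move=> l v; apply: thin_inh => b vb.
have same w : bag far_adj ball_lev l v w -> far w /\ same_root v w.
  move=> [_ [u vu uw]]; split; first by case: uw.
  apply: (@same_root_trans _ _ _ _ _ u _); last exact: far_adj_same_root.
  apply: (chain_ind_all _ _ vu) => [|y z vy _ _ yz].
    by case: (chain_adjl vu) => -[vv _] _ _; exact: same_rootxx.
  by apply: same_root_trans vy _; exact: far_adj_same_root.
have [u0 vu0 _] := vb.2; have [[vv fv] _ _] := chain_adjl vu0.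
have lv : (lev v <= l)%N.
  apply: leq_trans (chainl vu0).
  exact: (lev_max_lev adjE levE ball_conn (walkxx hop vv)).
(* If the node is not below the root, the level of [b] is attained within [hop] of [b], which is too
   high for a far vertex. *)
have [tl|lt] := leqP (top v) l.
  exfalso; have [[bb fb] [tvb _]] := same _ vb; case: vb => lb [u _ ub].
  have [x bx lx] := max_lev_attained adjE levE ball_conn E'M (adjr aE' ub).
  have hf : (hop <= far_radius)%N by rewrite /far_radius; lia.
  have nb : ~ near hop b := fun n => fb (nearW adjE hf n).
  have [] := walk_far adjE levE bx nb.
  by rewrite lx -tvb; move: lb; rewrite /ball_lev; lia.
(* Below the root, the node did not start a new subtree, so its bag is linked to the root bag; [h]
   is the vertex to delete. *)
have [h [r [vh rr hr]]] : exists h r, [/\ bag E lev l v h, root_bag v r & walk E 2 h r].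
  have lL : (l < Lm)%N by case/andP: (top_ge levE vv) => *; lia.
  have := root_level_top (lev := lev) (Lm := Lm) (l := l) vv.
  rewrite lv ltnW // => /(_ isT).
  rewrite root_levelE //; case: ifPn => [/asboolP[h [r [vh vr hr]]] e|_ e].
    by exists h, r; split=> //; rewrite /root_bag -e.
  by move: lt; rewrite -e ltnn.
apply: (@thin_map _ _ E _ (fun w x => walk E hop w x /\ far_adj w w))
  (treeE vh) => [w vw|w1 w2 u1 u2 [wu1 [f1 _ _]] [wu2 [f2 _ _]] uu]; last first.
  by split=> //; exists u1, u2.
have [w' ww' vw'] := merge_bag adjE aE' levE ball_conn E'M vw.
have [fw vw_] := same _ vw.
exists w'; last by split=> //; apply: walk_far_adj => //; apply: walkxx; case: fw.
split=> // hw'; case: (fw) => _; apply.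
(* From [w] it takes [hop] steps to [w'], one edge to [h] and two steps to the root bag. *)
apply: (@nearW _ _ _ _ adjE (hop + 1 + 2)).
  by rewrite /far_radius /hop; lia.
exists r; first by rewrite -(same_root_bag adjE vw_).
apply: walk_trans hr; rewrite addn1; exists w' => //; exact: adjC.
Qed.

(** * Bounds for the two colours *)

Section Colors.
Variables (W' : V -> Prop) (D' : nat).
Hypothesis W'D : chains_bounded far_adj far_adj W' D'.
Hypothesis W'nD : chains_bounded far_adj far_adj (fun v => ~ W' v) D'.

(** Layers around each root bag: a core up to distance 1 in the first colour, a ring at 2 in the
    second, a collar up to [far_radius] in the first, then the recursive colouring [W']. *)
Definition first_color (v : V) : Prop :=
  near 1 v \/ ~ near 2 v /\ (near far_radius v \/ W' v).

Let far_diam : nat := (D' * far_radius)%N.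

Lemma far_radius3 : (3 <= far_radius)%N.
Proof. by rewrite /far_radius /hop; lia. Qed.

Lemma far_walk x y : walk far_adj D' x y -> walk E far_diam x y.
Proof.
move=> w; apply: walk_iter; apply: walk_sub w; exact: far_adj_walk.
Qed.

Lemma second_color_cases v : ~ first_color v ->
  near 2 v /\ ~ near 1 v \/ ~ near far_radius v /\ ~ W' v.
Proof.
move=> nv; have [n2|n2] := pselect (near 2 v).
  by left; split=> // n1; apply: nv; left.
right; split=> [n|w]; apply: nv; right; split=> //; [left|right]; done.
Qed.

Lemma not_near3 v : ~ near far_radius v -> ~ near 3 v.
Proof. by move=> nv n3; apply: nv; apply: nearW n3 => //; exact: far_radius3. Qed.

Lemma not_near2 v : ~ near far_radius v -> ~ near 2 v.
Proof. by move=> /not_near3 nv n2; apply: nv; apply: nearW n2. Qed.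

Lemma not_near1_step v w : ~ near 1 v -> ~ near 1 w -> E v w -> same_root v w.
Proof.
move=> nv nw vw; have [//|b|b] := step_same_root adjE levE vw.
  by case: nv; exists w => //; exact: walk1.
by case: nw; exists v => //; apply: walk1 => //; exact: adjC.
Qed.

(** Off the cores no edge changes subtree, and the collar separates rings from far vertices. Rings
    are bounded by thinness of the root bag, far chains by [W'nD]. *)
Lemma second_color_bounded : chains_bounded E E (fun v => ~ first_color v)
  (K.+1 * (2 + 3 + 1) + far_diam).
Proof.
move=> x y xy; have /second_color_cases[[n2x n1x]|[nx Wx]] := chainl xy.
  apply: (@walkW _ _ adjE (K.+1 * (2 + 3 + 1))); first exact: leq_addr.
  apply: (root_chain_bounded adjE treeE adjE (walk1 adjE) xy) => z.
  apply: (@chain_ind_all _ _ _ (fun z => same_root x z /\ near 2 z))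
    => [|u v [xu n2u] nu nv uv].
    by split=> //; apply: same_rootxx => //; exact: chain_adjl xy.
  have n1u : ~ near 1 u by move=> n; apply: nu; left.
  have n1v : ~ near 1 v by move=> n; apply: nv; left.
  have suv := not_near1_step n1u n1v uv.
  split; first exact: same_root_trans suv.
  have [[]//|[/not_near3[]]] := second_color_cases nv.
  apply: (near_step adjE (same_rootC adjE suv) (n := 1)) n2u.
  by apply: walk1 => //; exact: adjC.
apply: (@walkW _ _ adjE far_diam); first exact: leq_addl.
apply: far_walk; apply: W'nD.
have far_all z : chain (fun v => ~ first_color v) E x z ->
    ~ near far_radius z /\ ~ W' z.
  apply: (@chain_ind_all _ _ _ (fun z => ~ near far_radius z /\ ~ W' z)) =>
    // u v [nu Wu] _ nv uv.
  have [[n2v n1v]|//] := second_color_cases nv; case: (not_near3 nu).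
  have n1u : ~ near 1 u by move=> /(nearW adjE (isT : 1 <= 2)%N)/(not_near2 nu).
  by have := near_step adjE (not_near1_step n1u n1v uv) (walk1 adjE uv) n2v.
apply: chain_sub (chain_prefix xy) =>
  [z /far_all[]//|u v /far_all[nu _] /far_all[nv _] uv].
apply: walk_far_adj; [split=> //; exact: adjl uv|split=> //; exact: adjr uv|].
by apply: walkW (walk1 adjE uv); rewrite // (leq_trans _ far_radius3).
Qed.

(** An edge changing subtree would put a vertex near its own root bag into the root bag of another
    subtree, against [root_bag_near]. *)
Lemma near1_same_root v w : near 1 v -> near 1 w -> E v w -> same_root v w.
Proof.
move=> nv nw vw; have [//|b|b] := step_same_root adjE levE vw.
  by apply: root_bag_near b => //; exact: nearW nw.
by apply: same_rootC => //; apply: root_bag_near b => //; exact: nearW nv.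
Qed.

Lemma near1_chain x y : chain (near 1) E x y ->
  same_root x y /\ walk E near_diam x y.
Proof.
move=> xy; have sr z : chain (near 1) E x z -> same_root x z.
  apply: (@chain_ind_all _ _ _ (same_root x)) => [|u v xu n1u n1v uv].
    by apply: same_rootxx => //; exact: chain_adjl xy.
  by apply: same_root_trans xu _; exact: near1_same_root.
split; first exact: sr.
apply: (root_chain_bounded adjE treeE adjE (walk1 adjE) xy) => z xz.
by split; [exact: sr|exact: chainr xz].
Qed.

Lemma near1_root_bag v w : near 1 v -> ~ near 2 w -> E v w -> root_bag v w.
Proof.
move=> nv nw vw; have wv := adjC adjE vw; have [s|//|b] := step_same_root adjE levE vw.
  by case: nw; have := near_step adjE (same_rootC adjE s) (walk1 adjE wv) nv.
case: nw; apply: (near_step adjE (k := 1) (n := 1) _ (walk1 adjE wv) nv).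
by apply: root_bag_near b => //; exact: nearW nv.
Qed.

Let N (v : V) : Prop := first_color v /\ ~ near 2 v.

(** A long step inside one subtree, replacing a passage through the core of a child subtree. *)
Let H (v w : V) : Prop := walk E hop v w /\ same_root v w.

Let adjH : adjacency H.
Proof.
split=> v w [vw s]; split; [exact: walkC|exact: same_rootC| |].
  by apply: walkxx; exact: walkl vw.
by apply: same_rootxx => //; exact: walkl vw.
Qed.

Let H_same_root x y : chain N H x y -> same_root x y.
Proof.
move=> xy; apply: (chain_ind_all _ _ xy) => [|u v xu _ _ [_ uv]].
  by have [] := chain_adjl xy.
exact: same_root_trans uv.
Qed.

(** After its last vertex near [k], the chain makes one hop and continues as a far chain in [W'], of
    extent at most [far_diam]. *)
Lemma far_exit k x y : (far_radius <= k)%N -> chain N H x y ->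
  ~ near k x /\ walk E far_diam x y \/ near (hop + far_diam + k) y.
Proof.
move=> rk.
have run a b : chain (fun z => N z /\ ~ near k z) H a b -> walk E far_diam a b.
  move=> ab; apply: far_walk; apply: W'D; apply: chain_sub ab.
    move=> z [[[n1|[_ [n|//]]] n2] nk]; first by case: n2; exact: nearW n1.
    by case: nk; exact: nearW n.
  have farz z w : ~ near k z -> walk E hop z w -> far z.
    by move=> nk zw; split=> [|n]; [exact: walkl zw|apply: nk; exact: nearW n].
  move=> u v [_ nu] [_ nv] [uv _]; apply: walk_far_adj.
  - exact: farz uv.
  - by apply: farz nv _; apply: walkC => //; exact: uv.
  - by apply: walkW uv => //; rewrite /far_radius; lia.
move=> xy; have [r|[z [nz xz e]]] := chain_last_exit (near k) adjH xy.
  by left; split; [have [] := chainl r|exact: run].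
right; case: e => [<-|[z' [zz' _] /[dup] /run z'y z'y_]].
  by apply: nearW nz => //; lia.
have zy : walk E (hop + far_diam) z y := walk_trans zz' z'y.
apply: (near_step adjE _ (walkC adjE zy) nz).
by apply: same_root_trans (H_same_root xz); apply: same_rootC => //; exact: H_same_root.
Qed.

Let exit_diam : nat := (hop + far_diam + (hop + far_diam + far_radius))%N.

Lemma H_chain_bounded x y : chain N H x y ->
  walk E (far_diam + K.+1 * (exit_diam + exit_diam.+1 + hop)) x y.
Proof.
move=> xy; have [[_ w]|ny] := far_exit (leqnn _) xy.
  by apply: (walkW adjE _ w); exact: leq_addr.
(* Read from [y], now known to be near, the whole chain stays within [exit_diam] of the root bag. *)
apply: walkC => //; apply: (@walkW _ _ adjE (K.+1 * (exit_diam + exit_diam.+1 + hop))).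
  exact: leq_addl.
have yx := chainC adjH xy.
apply: (root_chain_bounded adjE treeE adjH _ yx) => [u v []//|z yz].
split; first exact: H_same_root.
have rk : (far_radius <= hop + far_diam + far_radius)%N by exact: leq_addl.
by have [[]|] := far_exit rk yz.
Qed.

(** Runs in the cores are contracted. The outer neighbours of a run lie in the parent subtree at
    distance at most [hop], which leaves an [H]-chain with at most one run at each end. *)
Lemma first_color_bounded : chains_bounded E E first_color
  (near_diam.+1 + (far_diam + K.+1 * (exit_diam + exit_diam.+1 + hop)) +
   near_diam.+1).
Proof.
move=> x y xy.
have : chain (fun z => near 1 z \/ N z) E x y.
  by apply: chain_sub xy => // z cz; case: (cz) => [|[]]; [left|right].
move=> /(chain_absorb (H := H) adjE)[].
- move=> b z [_ nb] [_ nz] bz; split; first by apply: walkW (walk1 adjE bz).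
  by apply: not_near1_step => // /(nearW adjE (isT : 1 <= 2)%N).
- move=> b b' z' z [_ nb] bb' b'z' z'z [_ nz].
  have [s w] := near1_chain b'z'; have b'b := adjC adjE bb'; split.
    rewrite /hop -addn1 -add1n.
    by apply: walk_trans (walk_trans (walk1 adjE bb') w) (walk1 adjE z'z).
  apply: (parent_same_root adjE levE s).
  + exact: near1_root_bag (chainl b'z') nb b'b.
  + exact: near1_root_bag (chainr b'z') nz z'z.
  + by move=> /(nearW adjE (isT : 0 <= 2)%N).
  + by move=> /(nearW adjE (isT : 0 <= 2)%N).
- by move=> /near1_chain[_]; apply: walkW => //; lia.
move=> [a [b [xa ab yb]]]; have end_walk u v : u = v \/
    (exists2 u', chain (near 1) E u u' & E u' v) -> E v v -> walk E near_diam.+1 u v.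
  case=> [->|[u' /near1_chain[_ uu'] u'v]] vv; first exact: walkxx.
  by exists u'.
have [aa _] := chain_adjl ab; have [bb _] := chain_adjr adjH ab.
have xa' := end_walk _ _ xa (walkl aa).
apply: walk_trans (walk_trans xa' (H_chain_bounded ab)) _.
apply: walkC => //; apply: end_walk (walkl bb).
case: yb => [->|[y' by' y'y]]; [by left|right; exists y'; last exact: adjC].
exact: chainC.
Qed.

End Colors.
End TwoColoring.

(** Induction on [K] through the far graph. The bound [D] depends on [K] alone, not on the number of
    levels. *)
Theorem tree_two_coloring (K : nat) : exists D, forall (V : Type)
    (E : V -> V -> Prop) (lev : V -> nat) (Lm : nat), adjacency E ->
    (forall x, E x x -> (lev x <= Lm)%N) -> tree_like E lev K ->
  exists W : V -> Prop,
    chains_bounded E E W D /\ chains_bounded E E (fun v => ~ W v) D.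
Proof.
elim: K => [|K [D' IH]].
  exists 0%N => V E lev Lm aE lE tE; exists (fun=> True).
  suff bnd Q : chains_bounded E E Q 0 by split; exact: bnd.
  (* A vertex of the support lies in the bag of its own node, so empty bags leave no vertex. *)
  move=> x y xy; have xx := chain_adjl xy; case: (tE (lev x) x x); split=> //.
  by exists x => //; exact: chain0.
eexists (_ + _)%N => V E lev Lm aE lE tE.
have [W' [W'D W'nD]] := IH _ _ _ _ (far_adj_adjacency lev Lm K aE)
  (fun x _ => max_lev_le lev Lm _ x) (far_tree_like aE lE tE).
exists (first_color E lev Lm K W'); split=> x y xy.
  by apply: (walkW aE _ (first_color_bounded aE lE tE W'D xy)); exact: leq_addr.
by apply: (walkW aE _ (second_color_bounded aE lE tE W'nD xy)); exact: leq_addl.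
Qed.

(** * Gluing two-colourings with one common colour *)

Definition restr (V : Type) (Y : V -> Prop) (E : V -> V -> Prop) (v w : V) :
  Prop := [/\ Y v, Y w & E v w].

Lemma restr_adj (V : Type) (Y : V -> Prop) (E : V -> V -> Prop) :
  adjacency E -> adjacency (restr Y E).
Proof.
move=> aE; split=> v w [Yv Yw vw]; split=> //; first exact: adjC.
exact: adjl vw.
Qed.

Section Overflow.
Variables (V : Type) (e : V -> V -> Prop) (T t : nat) (Y U : V -> Prop).
Variables (lev : V -> nat) (Lm D0 : nat).
Hypotheses (adje : adjacency e) (tT : (t <= T)%N).
Hypothesis UD : chains_bounded e (walk e (3 * t)) U D0.

Let E := restr Y (walk e T).

Let adjE : adjacency E := restr_adj _ (walk_adj adje T).

Hypothesis levE : forall x, E x x -> (lev x <= Lm)%N.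

Let F (v : V) : Prop := Y v /\ exists2 u, U u & walk e t v u.

Let F_diam : nat := (t + D0 + t)%N.

Let stepE v w : Y v -> Y w -> walk e t v w -> E v w.
Proof. by move=> Yv Yw vw; split=> //; exact: walkW vw. Qed.

(** Members of [F] have companions in [U] at distance [t], so consecutive companions are within
    [3 * t]. *)
Let F_bounded : chains_bounded e (walk e t) F F_diam.
Proof.
move=> x y xy; have [_ [u Uu xu]] := chainl xy.
suff [u' yu' uu'] : exists2 u', walk e t y u' & chain U (walk e (3 * t)) u u'.
  by apply: walk_trans (walk_trans xu (UD uu')) (walkC adje yu').
elim: xy => [_ xx|z z' xz [u' zu' uu'] zz' [_ [u'' Uu'' z'u'']]].
  by exists u => //; apply: chain0 => //; apply: walkxx; exact: walkr xu.
exists u'' => //; apply: (chainS uu' _ Uu'').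
rewrite (_ : 3 * t = t + t + t)%N; last by lia.
exact: walk_trans (walk_trans (walkC adje zu') zz') z'u''.
Qed.

(* Contracting the components of [F] in unit balls makes a component of [F]
   harmless whatever the colours around it. *)
Let blob (v x : V) : Prop :=
  exists2 z, E v z & z = x \/ chain F (walk e t) z x.

Let E' (v w : V) : Prop := exists x y, [/\ blob v x, blob w y & E x y].

Let blob_refl v : E v v -> blob v v.
Proof. by exists v => //; left. Qed.

Let adjE' : adjacency E'.
Proof.
split=> v w [x [y [vx wy xy]]].
  by exists y, x; split=> //; exact: adjC.
case: vx => z vz _; have vv := adjl adjE vz.
by exists v, v; split=> //; exact: blob_refl.
Qed.

Let EE' v w : E v w -> E' v w.
Proof.
move=> vw; exists v, w; split=> //; apply: blob_refl.
  exact: adjl vw.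
exact: adjr vw.
Qed.

Let blob_conn v x : blob v x -> chain (blob v) E v x.
Proof.
move=> [z vz zx]; have vv := adjl adjE vz.
have vz' : chain (blob v) E v z.
  by apply: (chainS _ vz); [apply: chain0 => //; exact: blob_refl|exists z => //; left].
case: zx => [<-//|zx]; apply: chain_trans vz' _.
apply: chain_sub (chain_prefix zx) => [u zu|u u' zu zu' uu'].
  by exists z => //; right.
by have [[Yu _] [Yu' _]] := (chainr zu, chainr zu'); exact: stepE.
Qed.

Let E'_diam : nat := (T + F_diam + T + (T + F_diam))%N.

Let E'_walk v w : E' v w -> walk e E'_diam v w.
Proof.
have bw u x : blob u x -> walk e (T + F_diam) u x.
  move=> [z [_ _ uz] [<-|/F_bounded zx]]; last exact: walk_trans uz zx.
  by apply: walkW uz => //; exact: leq_addr.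
move=> [x [y [/bw vx /bw wy [_ _ xy]]]].
exact: walk_trans (walk_trans vx xy) (walkC adje wy).
Qed.

(** Removing [F] from the new set [W] keeps it away from [U]; [F] joins the other class, where the
    blobs absorb its components. *)
Lemma overflow_exists K D : tree_like E lev K ->
    (forall (V : Type) (E : V -> V -> Prop) (lev : V -> nat) (Lm : nat),
      adjacency E -> (forall x, E x x -> (lev x <= Lm)%N) ->
      tree_like E lev K ->
      exists W : V -> Prop,
        chains_bounded E E W D /\ chains_bounded E E (fun v => ~ W v) D) ->
  let D1 := (F_diam + t + D * E'_diam + (t + F_diam))%N in
  exists W : V -> Prop,
    [/\ forall v w, W v -> U w -> ~ walk e t v w,
        chains_bounded e (walk e t) W D1
      & chains_bounded e (walk e t) (fun v => Y v /\ ~ W v) D1].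
Proof.
move=> tE twocol D1; have tE' : tree_like E' (max_lev lev Lm blob) K.
  apply: merge_tree_like tE => // v w x y vv ww vx wy xy.
  by exists x, y.
have [W0 [W0D W0nD]] := twocol _ _ _ _ adjE' (fun x _ => max_lev_le lev Lm _ x) tE'.
have colour_walk x y : walk E' D x y -> walk e (D * E'_diam) x y.
  by move=> w; apply: walk_iter; apply: walk_sub w; exact: E'_walk.
exists (fun v => [/\ Y v, ~ F v & W0 v]); split.
- by move=> v w [Yv nF _] Uw vw; apply: nF; split=> //; exists w.
- move=> x y xy.
  apply: (walkW adje _ (colour_walk _ _ (W0D _ _ _))); first by rewrite /D1; lia.
  apply: chain_sub xy => [z []//|u v [Yu _ _] [Yv _ _] uv].
  by apply: EE'; exact: stepE.
move=> x y xy.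
pose N v := [/\ Y v, ~ F v & ~ W0 v].
have : chain (fun z => F z \/ N z) (walk e t) x y.
  apply: chain_sub xy => // z [Yz nW]; have [Fz|nFz] := pselect (F z); first by left.
  by right; split=> // W0z; apply: nW.
move=> /(chain_absorb (H := E') (walk_adj adje t))[].
- by move=> b z [Yb _ _] [Yz _ _] bz; apply: EE'; exact: stepE.
- move=> b b' z' z [Yb _ _] bb' b'z' z'z [Yz _ _].
  have [Yb' _] := chainl b'z'; have [Yz' _] := chainr b'z'.
  (* The run from [b'] to [z'] is contained in the blob of [b]. *)
  exists z', z; split; [|apply: blob_refl|exact: stepE].
    by exists b'; [exact: stepE|right].
  by apply: stepE => //; exact: (adjr (walk_adj adje t) z'z).
- by move=> c; apply: (walkW adje _ (F_bounded c)); rewrite /D1; lia.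
move=> [a [b [xa ab yb]]].
have end_walk u v : u = v \/
    (exists2 u', chain F (walk e t) u u' & walk e t u' v) -> e v v ->
    walk e (F_diam + t) u v.
  case=> [->|[u' /F_bounded uu' u'v]] vv; first exact: walkxx.
  exact: walk_trans uu' u'v.
have supp u v : E' u v -> e u u.
  by case=> x' [_ [[z [_ _ uz] _] _ _]]; exact: walkl uz.
have xa' := end_walk _ _ xa (supp _ _ (chain_adjl ab)).
apply: walk_trans (walk_trans xa' (colour_walk _ _ (W0nD _ _ _))) _.
  by apply: chain_sub ab => // z [].
apply: walkC => //; rewrite addnC.
apply: end_walk (supp _ _ (chain_adjr adjE' ab)).
case: yb => [->|[y' by' y'y]]; [by left|right; exists y'; last exact: walkC].
by apply: chainC => //; exact: walk_adj.
Qed.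

End Overflow.

(** Each colour adds to the shared set [U] a part that stays away from the earlier ones at a
    distance three times smaller, so components of the union lie in a single part. *)
Lemma tree_like_cover_bounded (T K n r : nat) : (3 ^ n * r <= T)%N ->
  exists D, forall (V : Type) (e : V -> V -> Prop) (Y : nat -> V -> Prop)
      (lev : V -> nat) (Lm : nat), adjacency e ->
      (forall x, e x x -> (lev x <= Lm)%N) ->
      (forall a, (a < n)%N -> tree_like (restr (Y a) (walk e T)) lev K) ->
    exists U : V -> Prop, chains_bounded e (walk e r) U D /\
      forall a, (a < n)%N ->
        chains_bounded e (walk e r) (fun v => Y a v /\ ~ U v) D.
Proof.
elim: n r => [|n IH] r rT.
  exists 0%N => V e Y lev Lm _ _ _; exists (fun=> False); split=> // x y xy.
  by case: (chainl xy).
have [|D0 {}IH] := IH (3 * r)%N; first by move: rT; rewrite expnS; lia.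
have [D twocol] := tree_two_coloring K.
have rT' : (r <= T)%N.
  by apply: leq_trans rT; rewrite -{1}[r]mul1n leq_mul2r expn_gt0 orbT.
eexists (D0 + _)%N => V e Y lev Lm ae le tY.
have [|U [UD YUD]] := IH V e Y lev Lm ae le.
  by move=> a an; apply: tY; exact: ltnW.
have levE x : restr (Y n) (walk e T) x x -> (lev x <= Lm)%N.
  by move=> [_ _ xx]; apply: le; exact: walkl xx.
have [W [WU WD YWD]] := overflow_exists ae rT' UD levE (tY n (ltnSn n)) twocol.
have r3 x y : walk e r x y -> walk e (3 * r) x y by apply: walkW => //; lia.
exists (fun v => U v \/ W v); split.
  move=> x y xy; case: (chainl xy) => [Ux|Wx].
    apply: (@walkW _ _ ae D0); first exact: leq_addr.
    apply: UD; have U_all z : chain (fun v => U v \/ W v) (walk e r) x z -> U z.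
      apply: (@chain_ind_all _ _ _ U) => // u v Uu _ [//|Wv] uv.
      by case: (WU v u) => //; exact: walkC.
    by apply: chain_sub (chain_prefix xy) => // u v _ _; exact: r3.
  have W_all z : chain (fun v => U v \/ W v) (walk e r) x z -> W z.
    by apply: (@chain_ind_all _ _ _ W) => // u v Wu _ [Uv|//] /(WU _ _ Wu Uv).
  apply: (walkW ae _ (WD _ _ (chain_sub W_all _ (chain_prefix xy)))) => //.
  exact: leq_addl.
move=> a; rewrite ltnS leq_eqVlt => /predU1P[->|an] x y xy.
  apply: (walkW ae _ (YWD x y _)); first exact: leq_addl.
  by apply: chain_sub xy => // z [Yz nz]; split=> // Wz; apply: nz; right.
apply: (@walkW _ _ ae D0); first exact: leq_addr.
apply: (YUD a an); apply: chain_sub xy => [z [Yz nz]|u v _ _]; last exact: r3.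
by split=> // Uz; apply: nz; left.
Qed.

Lemma tree_like_cover_coloring (T K n r : nat) : (3 ^ n * r <= T)%N ->
  exists D, forall (V : Type) (e : V -> V -> Prop) (Y : nat -> V -> Prop)
      (lev : V -> nat) (Lm : nat), adjacency e ->
      (forall x, e x x -> (lev x <= Lm)%N) ->
      (forall x, e x x -> exists2 a, (a < n)%N & Y a x) ->
      (forall a, (a < n)%N -> tree_like (restr (Y a) (walk e T)) lev K) ->
    exists c : V -> nat, (forall v, (c v <= n)%N) /\
      forall i, chains_bounded e (walk e r) (fun v => c v = i) D.
Proof.
move=> rT; have [D HD] := tree_like_cover_bounded K rT.
exists D => V e Y lev Lm ae le Ye tY.
have [U [UD YUD]] := HD _ _ _ _ _ ae le tY.
have /choice[c cP] v : exists i, (i <= n)%N /\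
    (e v v -> i = n /\ U v \/ [/\ (i < n)%N, Y i v & ~ U v]).
  have [Uv|nUv] := pselect (U v); first by exists n; split=> // _; left.
  have [/Ye[a an Ya]|nv] := pselect (e v v); last by exists 0%N.
  by exists a; split=> [|_]; [exact: ltnW|right].
exists c; split=> [v|i x y xy]; first by case: (cP v).
have sup z : chain (fun v => c v = i) (walk e r) x z -> e z z /\ c z = i.
  by move=> xz; split; [exact: walkl (chain_adjr (walk_adj ae r) xz)|exact: chainr xz].
have [xx cx] := sup x (chain0 (chainl xy) (chain_adjl xy)).
have [i_n|i_n] := eqVneq i n.
  apply: UD; apply: chain_sub (chain_prefix xy) => // z /sup[/(cP z).2 zP cz].
  by case: zP => [[]//|[]]; rewrite cz i_n ltnn.
have lt_in : (i < n)%N by rewrite ltn_neqAle i_n -cx (cP x).1.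
apply: (YUD i lt_in); apply: chain_sub (chain_prefix xy) => // z /sup[/(cP z).2 zP cz].
by case: zP => [[e1 _]|[_]]; rewrite -?cz //; move: i_n; rewrite -cz e1 eqxx.
Qed.

(** * Space-filling families *)

Lemma not_thin_sequence (V : Type) (E : V -> V -> Prop) K B : ~ thin E K B ->
  exists g : nat -> V, (forall i, (i <= K)%N -> B (g i)) /\
    forall i j, (i < j <= K)%N -> ~ E (g i) (g j).
Proof.
elim: K B => [|K IH] B /=.
  move=> /existsNP[b /contrapT Bb]; exists (fun=> b); split=> // i j.
  by case/andP => ij; rewrite leqn0 => /eqP j0; move: ij; rewrite j0.
move=> /existsNP[b /not_implyP[Bb /IH[g [gB gE]]]].
exists (fun i => if i is i'.+1 then g i' else b).
split=> [[//|i] iK|[|i] [//|j] ijK]; first by case: (gB i iK).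
  by case: (gB j) => //; case/andP: ijK.
exact: gE.
Qed.

Section Metric.
Variables (R : realType) (X : Type) (d : X -> X -> \bar R).
Hypothesis hd : extended_metric d.
Implicit Types (r s : R) (x y z : X).

Definition within x y r : Prop := (d x y <= r%:E)%E.

Lemma withinC x y r : within x y r -> within y x r.
Proof. by case: hd => _ _ dC _; rewrite /within dC. Qed.

Lemma withinW x y r s : r <= s -> within x y r -> within x y s.
Proof. by move=> rs /le_trans; apply; rewrite lee_fin. Qed.

Lemma within_trans x y z r s : within x y r -> within y z s -> within x z (r + s).
Proof.
case: hd => _ _ _ dT xy yz; apply: le_trans (dT x y z) _.
by rewrite EFinD; exact: leeD.
Qed.

Lemma withinxx x r : 0 <= r -> within x x r.
Proof. by case: hd => _ d0 _ _ r0; rewrite /within (d0 x x).2 // lee_fin. Qed.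

Lemma within0 x y : within x y 0 -> x = y.
Proof.
case: hd => dge d0 _ _ xy; apply: (d0 x y).1; apply/eqP.
by rewrite eq_le dge andbT.
Qed.

Lemma diam_within (A : set X) r x y :
  (diam d A <= r%:E)%E -> A x -> A y -> within x y r.
Proof.
move=> Ar Ax Ay; apply: le_trans Ar; rewrite /diam le_max; apply/orP; right.
by apply: ereal_sup_ubound; exists x => //; exists y.
Qed.

Lemma r_disjoint_within (U : set (set X)) r A B x y : r_disjoint d r U ->
  U A -> U B -> A x -> B y -> within x y r -> A = B.
Proof.
move=> rU UA UB Ax By xy; apply: contrapT => AB.
have := rU A B UA UB AB; rewrite ltNge => /negP; apply.
apply: le_trans xy; apply: ereal_inf_lbound.
by exists x => //; exists y.
Qed.

End Metric.

Definition meets (X I : Type) (S : I -> set X) (F : set I) : I -> I -> Prop :=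
  restr F (fun i j => S i `&` S j !=set0).

Lemma meets_adj (X I : Type) (S : I -> set X) (F : set I) : adjacency (meets S F).
Proof.
apply: restr_adj; split=> i j [x]; first by rewrite setIC; exists x.
by move=> [Six _]; exists x.
Qed.

(** An independent sequence would give [K.+1] pairwise disjoint members, against the bound
    [f (r / s)]. *)
Lemma space_filling_thin (R : realType) (X : Type) (d : X -> X -> \bar R)
    (f : R -> R) (I : Type) (S : I -> set X) (F : set I) K r s x :
    space_filling d f S -> 0 < r -> 0 < s -> f (r / s) < K.+1%:R ->
  thin (meets S F) K (fun i => [/\ F i, (s%:E <= diam d (S i))%E
    & exists2 y, S i y & within d x y r]).
Proof.
move=> [_ fill] r0 s0 fK; apply: contrapT => /not_thin_sequence[g [gB gE]].
have disj i j : (i <= K)%N -> (j <= K)%N -> S (g i) `&` S (g j) !=set0 -> i = j.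
  move=> iK jK ij; have [Fi _ _] := gB i iK; have [Fj _ _] := gB j jK.
  case: (ltngtP i j) => // lij; exfalso.
    by apply: (gE i j); rewrite ?lij ?jK//; split.
  by apply: (gE j i); rewrite ?lij ?iK//; split=> //; rewrite setIC.
have /(_ (g @` `I_K.+1))[] := fill r s x r0 s0.
- by move=> _ _ [i /= iK <-] [j /= jK <-] /(disj _ _ iK jK) ->.
- by move=> _ [i /= iK <-]; have [] := gB i iK.
- move=> _ [i /= iK <-]; have [_ _ [y Sy xy]] := gB i iK.
  by exists y; split.
move=> k gk kf.
(* Members meeting the ball are nonempty, so equal terms of [g] share a point and [g] is
   injective. *)
have : (`I_K.+1 #= `I_k)%card.
  apply: card_eq_trans gk; rewrite card_eq_sym; apply: inj_card_eq.
  move=> i j; rewrite !inE /= => iK jK gij; apply: disj => //; rewrite gij.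
  by have [_ _ [y Sy _]] := gB j jK; exists y.
by move/card_eq_II => e; move: fK; rewrite e ltNge kf.
Qed.

(** * Scales, hulls and cells *)

Section Geometry.
Variables (R : realType) (X : Type) (d : X -> X -> \bar R).
Variables (I : Type) (S : I -> set X) (F : set I).
Variables (q K : nat) (c eps : R).
Variables (U : nat -> nat -> set (set X)) (bl : I -> nat) (Lm : nat).

(** The ratio of consecutive scales that closes the induction in [chain_diam]. *)
Let lam : R := 4 + 3 * c.
(** Two walks of length [q] from [v] visit at most [2 * (q + 1)] members. *)
Let tau : R := (2 * q + 2)%:R.

(* Level [0] is kept for the members of diameter [0], on which the
   space-filling hypothesis says nothing. *)
Definition scale (l : nat) : R := if l is 0 then 0 else eps * lam ^+ l.

Hypothesis hd : extended_metric d.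
Hypotheses (c0 : 0 < c) (eps0 : 0 < eps).
Hypothesis bl_small : forall i x y, F i -> S i x -> S i y ->
  within d x y (scale (bl i)).
Hypothesis bl_max : forall i, F i -> (bl i <= Lm)%N.
Hypothesis U_small : forall l a A x y, U l.+1 a A -> A x -> A y ->
  within d x y (c * (3 * (tau * scale l.+1))).
Hypothesis U_disj : forall l a A B x y, U l.+1 a A -> U l.+1 a B -> A x -> B y ->
  within d x y (3 * (tau * scale l.+1)) -> A = B.
Hypothesis fillS : forall l x, thin (meets S F) K (fun i => [/\ F i,
  (l < bl i)%N & exists2 y, S i y & within d x y (2 * (tau * scale l.+2))]).

Let e := meets S F.
Let adje : adjacency e := meets_adj S F.
Let T : nat := (q + q).+1.

Let hull (v : I) (x : X) : Prop := exists2 i, walk e q v i & S i x.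

Definition hull_lev : I -> nat := max_lev bl Lm (walk e q).

Definition meets_cell (a : nat) (v : I) : Prop :=
  exists A x, [/\ U (hull_lev v) a A, A x & hull v x].

Let lev := hull_lev.
Let E a := restr (meets_cell a) (walk e T).
Let adjE a : adjacency (E a) := restr_adj _ (walk_adj adje T).

Let lam1 : 1 <= lam. Proof. by move: c0; rewrite /lam; lra. Qed.

Let scale_ge0 l : 0 <= scale l.
Proof. by case: l => //= l; rewrite mulr_ge0 ?exprn_ge0 ?(le_trans _ lam1) ?ltW. Qed.

Let scaleS l : scale l.+2 = lam * scale l.+1.
Proof. by rewrite /scale [in LHS]exprS mulrCA. Qed.

Let scale_le l l' : (l <= l')%N -> scale l <= scale l'.
Proof.
move=> /subnK <-; elim: (l' - l)%N => // n IH; rewrite addSn; apply: le_trans IH _.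
case: (n + l)%N => [|k]; first exact: scale_ge0.
by rewrite scaleS ler_peMl.
Qed.

Let tau0 : 0 < tau. Proof. by rewrite /tau ltr0n addn2. Qed.

Let bl_e i : e i i -> (bl i <= Lm)%N. Proof. by case=> /bl_max. Qed.

Let ball_conn v x : walk e q v x -> chain (walk e q v) e v x.
Proof. exact: walk_chain. Qed.

Let bl_lev v i : walk e q v i -> (bl i <= lev v)%N.
Proof. exact: (lev_max_lev adje bl_e ball_conn). Qed.

Let lev_attained v : e v v -> exists2 i, walk e q v i & bl i = lev v.
Proof.
move=> vv; apply: (max_lev_attained adje bl_e ball_conn (E' := e)) => // u w uw.
exists u, w; split=> //; apply: walkxx => //; first exact: adjl uw.
exact: adjr uw.
Qed.

Let walk_F k v i : walk e k v i -> F i.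
Proof. by move=> /(walkr adje)[]. Qed.

Let hull_diam v x y : hull v x -> hull v y -> within d x y (tau * scale (lev v)).
Proof.
have from_v k i p z : (k <= q)%N -> walk e k v i -> S v p -> S i z ->
    within d p z (k.+1%:R * scale (lev v)).
  move=> + + Sp; have small j u u' : walk e q v j -> S j u -> S j u' ->
      within d u u' (scale (lev v)).
    move=> vj Su Su'; apply: (withinW _ (bl_small (walk_F vj) Su Su')).
    by apply: scale_le; exact: bl_lev.
  elim: k i z => [i z kq vi|k IH i z kq vi] Sz.
    rewrite mul1r; apply: small Sp _; first by apply: walkxx; exact: walkl vi.
    by case: vi => ->.
  have [j vj [_ _ [u [Sju Siu]]]] := vi.
  rewrite -natr1 mulrDl mul1r; apply: (within_trans hd (IH j u (ltnW kq) vj Sju)).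
  by apply: small Siu Sz; exact: walkW vi.
move=> [i vi Six] [j vj Sjy].
have [_ _ [p [Sp _]]] := walkl vi.
apply: (withinW _ (within_trans hd (withinC hd (from_v _ _ _ _ (leqnn q) vi Sp Six))
  (from_v _ _ _ _ (leqnn q) vj Sp Sjy))).
by rewrite -mulrDl -natrD /tau ler_wpM2r // ler_nat; lia.
Qed.

Let hull_meet v w : walk e T v w -> exists2 x, hull v x & hull w x.
Proof.
move=> /(walk_half adje)[i [j [vi [_ _ [x [Six Sjx]]] jw]]].
by exists x; [exists i|exists j => //; exact: walkC].
Qed.

(** Hulls of level [0] are single points, and consecutive ones share a point. *)
Let level0 a v u x y : chain (fun w => lev w < 1)%N (E a) v u ->
  hull v x -> hull u y -> x = y.
Proof.
have small w z z' : (lev w < 1)%N -> hull w z -> hull w z' -> z = z'.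
  rewrite ltnS leqn0 => /eqP w0 wz wz'; apply: (within0 hd).
  by have := hull_diam wz wz'; rewrite w0 mulr0.
move=> vu vx; elim: vu y => [v1 _ y|w w' _ IH [_ _ ww'] w'1 y w'y].
  exact: small.
have [z wz w'z] := hull_meet ww'.
by rewrite (IH z wz); exact: small w'z w'y.
Qed.

(* A chain of level at most [l] can leave a cell of level [l] neither through
   hulls of level [l] nor through chains of lower level, both of which are too
   small to reach another cell. *)
Let chain_diam a l v u x y : chain (fun w => lev w < l.+1)%N (E a) v u ->
  hull v x -> hull u y -> within d x y (tau * scale l.+1).
Proof.
have t_ge0 n : 0 <= tau * scale n by rewrite mulr_ge0 // ltW.
elim: l v u x y => [|l IH] v u x y vu vx uy.
  by rewrite (level0 vu vx uy); exact: withinxx.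
set t := tau * scale l.+1 in IH *.
(* The terms stand for a run of lower level, a hull, a cell, a hull and a run. *)
have tS : tau * scale l.+2 = t + t + c * (3 * t) + t + t.
  by rewrite scaleS /t /lam; lra.
have t0 : 0 <= t := t_ge0 l.+1.
have ct0 : 0 <= c * t by rewrite mulr_ge0 // ltW.
pose N w := lev w = l.+1.
have Nd w z z' : N w -> hull w z -> hull w z' -> within d z z' t.
  by move=> Nw wz wz'; have := hull_diam wz wz'; rewrite Nw.
pose cell A w := U l.+1 a A /\ exists2 z, A z & hull w z.
pose H b b' := exists A, cell A b /\ cell A b'.
have cell_eq A B b b' z z' : N b -> N b' -> cell A b -> cell B b' -> hull b z ->
    hull b' z' -> within d z z' t -> A = B.
  move=> Nb Nb' [UA [p Ap bp]] [UB [p' Bp' b'p']] bz b'z' zz'.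
  apply: (U_disj UA UB Ap Bp').
  have := within_trans hd (within_trans hd (Nd _ _ _ Nb bp bz) zz')
    (Nd _ _ _ Nb' b'z' b'p').
  by apply: withinW; rewrite -/t; lra.
have cellP b : N b -> meets_cell a b -> exists A, cell A b.
  move=> Nb [A [z [UA Az bz]]]; exists A; move: UA; rewrite [hull_lev _]Nb.
  by split=> //; exists z.
have HN b b' z z' : N b -> N b' -> meets_cell a b -> meets_cell a b' ->
    hull b z -> hull b' z' -> within d z z' t -> H b b'.
  move=> Nb Nb' /(cellP _ Nb)[A Ab] /(cellP _ Nb')[B Bb'] bz b'z' zz'.
  by exists A; split=> //; rewrite (cell_eq A B b b' z z').
have : chain (fun w => (lev w < l.+1)%N \/ N w) (E a) v u.
  by apply: chain_sub vu => // w; rewrite ltnS leq_eqVlt => /predU1P[|]; [right|left].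
move=> /(chain_absorb (H := H) (adjE a))[].
- move=> b b' Nb Nb' [Yb Yb' /hull_meet[z bz b'z]].
  by apply: (HN b b' z z) => //; exact: withinxx.
- move=> b b1 b2 b' Nb [Yb _ /hull_meet[z bz b1z]] b12.
  move=> [_ Yb' /hull_meet[z' b2z' b'z']] Nb'.
  by apply: (HN b b' z z') => //; exact: IH b12 b1z b2z'.
- by move=> vu'; apply: withinW (IH _ _ _ _ vu' vx uy); rewrite tS; lra.
move=> [b [b' [vb bb' b'u]]].
have end_within w z b0 : hull w z -> w = b0 \/
    (exists2 w', chain (fun w => lev w < l.+1)%N (E a) w w' & E a w' b0) ->
    exists2 p, hull b0 p & within d z p t.
  move=> wz [<-|[w' ww' [_ _ /hull_meet[p w'p b0p]]]].
    by exists z => //; exact: withinxx.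
  by exists p => //; exact: IH ww' wz w'p.
have [p bp xp] := end_within _ _ _ vx vb.
have [|p' b'p' yp'] := end_within _ _ b' uy.
  case: b'u => [->|[y' by' y'u]]; [by left|right].
  by exists y'; [apply: chainC|apply: adjC].
have [A [[UA [z Az bz]] [_ [z' Az' b'z']]]] : H b b'.
  elim: bb' {b'u p' b'p' yp'} => [_ //|w w' bw [A [Ab Aw]] [B [Bw Bw']] Nw'].
  have Nw := chainr bw; have [_ [p' _ wp']] := Aw.
  exists A; split=> //; rewrite (cell_eq A B w w p' p') //.
  exact: withinxx.
have Nb := chainl bb'; have Nb' := chainr bb'.
have := within_trans hd (within_trans hd (within_trans hd (within_trans hd xp
  (Nd _ _ _ Nb bp bz)) (U_small UA Az Az')) (Nd _ _ _ Nb' b'z' b'p')) (withinC hd yp').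
by rewrite tS.
Qed.

(** Walk from [w'] to [w], then to a member attaining the level of [w], stopping at the first member
    of level at least [l]. At most [q + q] members are crossed before, each of diameter at most
    [scale l]. *)
Let hit l w w' x y D : walk e q w w' -> S w' y -> within d x y D ->
    (l <= lev w)%N ->
  exists i z, [/\ walk e q w i, (l <= bl i)%N, S i z &
    within d x z (D + (q + q)%:R * scale l)].
Proof.
move=> ww' Sy xy lw.
have ww := walkl ww'.
have [i0 wi0 li0] := lev_attained ww.
pose hitk n D' := exists i z, [/\ walk e n w i, (l <= bl i)%N, S i z & within d x z D'].
have small i z z' : F i -> (bl i < l)%N -> S i z -> S i z' -> within d z z' (scale l).
  by move=> Fi il Sz Sz'; apply: withinW (bl_small Fi Sz Sz'); exact: scale_le (ltnW il).
have hitW n n' D1 D2 : (n <= n')%N -> D1 <= D2 -> hitk n D1 -> hitk n' D2.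
  move=> nn DD [i [z [wi li Sz xz]]]; exists i, z; split=> //.
    exact: walkW wi.
  exact: withinW xz.
have mulS k D' : D' + scale l + k%:R * scale l = D' + k.+1%:R * scale l.
  by rewrite -natr1 mulrDl mul1r; lra.
have down k v z D' : walk e k w v -> S v z -> within d x z D' ->
    hitk k (D' + k%:R * scale l) \/
    exists2 z', S w z' & within d x z' (D' + k%:R * scale l).
  elim: k v z D' => [v z D' [<- _] Sz xz|k IH v z D' wv Sz xz].
    by right; exists z => //; rewrite mul0r addr0.
  have [vl|lv] := ltnP (bl v) l; last first.
    left; exists v, z; split=> //; apply: withinW xz.
    by rewrite lerDl mulr_ge0.
  have [u wu [_ Fv [z' [Suz' Svz']]]] := wv.
  have xz' := within_trans hd xz (small _ _ _ Fv vl Sz Svz').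
  have := IH _ _ _ wu Suz' xz'; rewrite mulS => -[/hitW h|]; last by right.
  by left; apply: h.
have up k v z D' : walk e k w v -> S w z -> within d x z D' ->
    hitk k (D' + k%:R * scale l) \/
    exists2 z', S v z' & within d x z' (D' + k%:R * scale l).
  elim: k v => [v [<- _] Sz xz|k IH v [u wu [Fu _ [z' [Suz' Svz']]]] Sz xz].
    by right; exists z => //; rewrite mul0r addr0.
  have [/hitW h|[z1 Suz1 xz1]] := IH _ wu Sz xz.
    by left; apply: h => //; rewrite -mulS addrAC lerDl.
  have [ul|lu] := ltnP (bl u) l; last first.
    left; exists u, z1; split=> //; first exact: walkS.
    by apply: withinW xz1; rewrite -mulS addrAC lerDl.
  right; exists z' => //; rewrite -mulS addrAC.
  exact: within_trans xz1 (small _ _ _ Fu ul Suz1 Suz').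
suff : hitk q (D + (q + q)%:R * scale l) by [].
rewrite natrD mulrDl addrA.
have [/hitW h|[z1 Sz1 xz1]] := down _ _ _ _ ww' Sy xy.
  by apply: h => //; rewrite lerDl mulr_ge0.
have [//|[z2 Sz2 xz2]] := up _ _ _ _ wi0 Sz1 xz1.
by exists i0, z2; split=> //; rewrite li0.
Qed.

(** Vertices of a bag are represented by high-level members close to one point, where [fillS]
    applies. At level [0] the members through [x0] meet pairwise; the successor in [K.+1] leaves
    room for this case. *)
Lemma hull_tree_like a : tree_like (E a) lev K.+1.
Proof.
move=> l v; apply: thin_inh => _ [_ [u0 vu0 _]].
have [Yv _ vT] := chain_adjl vu0.
have vv := walkl vT; have [_ _ [x0 [Sx0 _]]] := vv.
have v0 : hull v x0 by exists v => //; exact: walkxx.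
have near_w w : bag (E a) lev l v w -> exists w' y,
    [/\ walk e q w w', S w' y, (l = 0%N -> y = x0)
      & within d x0 y (tau * scale l.+1)].
  move=> [lw [u vu [_ _ /(walk_half adje)[i [j [ui [_ _ [y [Siy Sjy]]] jw]]]]]].
  have uy : hull u y by exists i.
  exists j, y; split=> //; first exact: walkC.
    by move=> l0; move: vu; rewrite l0 => vu; rewrite (level0 vu v0 uy).
  exact: chain_diam vu v0 uy.
have rel (P : I -> Prop) : (forall w, bag (E a) lev l v w ->
      exists2 i, P i & walk e q w i) ->
    thin e K.+1 P -> thin (E a) K.+1 (bag (E a) lev l v).
  move=> bP; apply: (@thin_map _ _ _ _ (fun w i => meets_cell a w /\ walk e q w i)).
    by move=> w bw; have [i Pi wi] := bP w bw; exists i => //; split=> //;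
      case: bw => _ [u _ []].
  move=> w1 w2 u1 u2 [Y1 w1u1] [Y2 w2u2] uu; split=> //.
  by rewrite /T -addSn; apply: walk_trans (walkC adje w2u2); exists u1.
case: l vu0 near_w rel => [|l] _ near_w rel.
  apply: (rel (fun i => F i /\ S i x0)) => [w /near_w[i [y [wi Sy /(_ erefl) yx0 _]]]|].
    by exists i => //; split; [exact: walk_F wi|rewrite -yx0].
  move=> b [Fb Sb]; apply: thin_empty => i [[Fi Si]]; apply.
  by split=> //; exists x0.
apply: rel (thin_sub _ (thinS (fillS l x0))) => [w bw|i]; last exact.
have [w' [y [ww' Sy _ xy]]] := near_w w bw; case: bw => lw _.
have [i [z [wi li Sz xz]]] := hit ww' Sy xy lw.
exists i => //; split=> //; first exact: walk_F wi.
exists z => //; apply: withinW xz.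
have sl : scale l.+1 <= scale l.+2 := scale_le (leqnSn _).
have : (q + q)%:R * scale l.+1 <= tau * scale l.+2.
  by apply: ler_pM => //; rewrite /tau ler_nat; lia.
lra.
Qed.

End Geometry.

(** * Finite families *)

Lemma finite_set_bounded (I : Type) (F : set I) (g : I -> nat) :
  finite_set F -> exists N, forall i, F i -> (g i <= N)%N.
Proof.
move=> /(finite_image g)/finite_seqP[s gs].
exists (\max_(n <- s) n)%N => i Fi; apply: leq_bigmax_seq => //.
have : [set` s] (g i) by rewrite -gs; exists i.
by [].
Qed.

Lemma diam_ge0 (R : realType) (X : Type) (d : X -> X -> \bar R) (A : set X) :
  (0 <= diam d A)%E.
Proof. by rewrite /diam le_max lexx. Qed.

(** Finiteness supplies a smallest positive scale; the final bounds do not depend on it. *)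
Lemma finite_diam_gap (R : realType) (X I : Type) (d : X -> X -> \bar R)
    (S : I -> set X) (F : set I) : finite_set F ->
  exists2 eps : R, 0 < eps &
    forall i, F i -> (0 < diam d (S i))%E -> (eps%:E <= diam d (S i))%E.
Proof.
move=> finF.
have /choice[g gP] i : exists k : nat,
    (0 < diam d (S i))%E -> ((k.+1%:R^-1)%:E <= diam d (S i))%E.
  case: (diam d (S i)) => [x| |]; [|by exists 0%N; rewrite leey|by exists 0%N].
  exists (Num.truncn x^-1); rewrite lte_fin lee_fin => x0.
  rewrite -[leRHS]invrK lef_pV2 ?posrE ?invr_gt0 ?ltr0n //.
  by apply: ltW; exact: truncnS_gt.
have [N NP] := finite_set_bounded g finF.
exists N.+1%:R^-1 => [|i Fi i0]; first by rewrite invr_gt0 ltr0n.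
apply: le_trans (gP i i0); rewrite lee_fin lef_pV2 ?posrE ?ltr0n //.
by rewrite ler_nat ltnS NP.
Qed.

Lemma scale_level (R : realType) (c eps : R) (x : \bar R) : 0 < c -> 0 < eps ->
    (0 <= x)%E -> (x < +oo)%E ->
  exists l, (x <= (scale c eps l)%:E)%E /\
    forall l', (l' < l)%N -> ((scale c eps l')%:E < x)%E.
Proof.
move=> c0 eps0 x0 xoo.
have : exists l, (x <= (scale c eps l)%:E)%E.
  move: x x0 xoo => [x| |]//; rewrite lee_fin => x0 _.
  exists (Num.bound (x / eps)).+1; rewrite lee_fin /= mulrC -ler_pdivrMr //.
  apply: le_trans (ltW (upper_nthrootP (leqnSn _))) _.
  by rewrite lerXn2r ?nnegrE //; lra.
move=> ex; case: (ex_minnP ex) => l lP lmin; exists l; split=> // l' l'l.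
by rewrite ltNge; apply/negP => /lmin; rewrite leqNgt l'l.
Qed.

Lemma finite_coloring (R : realType) (X : Type) (d : X -> X -> \bar R) (m r : nat)
    (c : R) (f : R -> R) : extended_metric d -> 0 < c ->
    control_function d m (fun x => c * x) ->
  exists D, forall (I : Type) (S : I -> set X) (F : set I),
    space_filling d f S -> finite_set F ->
  exists col : I -> nat, (forall v, (col v <= m.+1)%N) /\
    forall i, chains_bounded (meets S F) (walk (meets S F) r)
      (fun v => col v = i) D.
Proof.
move=> hd c0 [_ ctl].
pose q := (3 ^ m.+1 * r)%N; pose tau : R := (2 * q + 2)%:R.
pose lam : R := 4 + 3 * c.
have tau0 : 0 < tau by rewrite /tau ltr0n addn2.
have lam0 : 0 < lam by rewrite /lam; lra.
(* The argument of [f] is the ratio of the radius in [fillS] to the lower bound [eps * lam ^+ l] on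
   diameters, which is the same at all levels and for all families. *)
pose K := Num.truncn (f (2 * tau * lam ^+ 2)).
have rT : (3 ^ m.+1 * r <= (q + q).+1)%N by rewrite -/q; lia.
have [D HD] := tree_like_cover_coloring K.+1 rT.
exists D => I S F fill finF.
have [eps eps0 gap] := finite_diam_gap d S finF.
have /choice[bl blP] i := scale_level c0 eps0 (diam_ge0 d (S i)) (fill.1 i).
have [Lm LmP] := finite_set_bounded bl finF.
(* The distance must be positive even for [l = 0], where only the covering property is used. *)
pose s l := 3 * (tau * (eps * lam ^+ l)).
have s0 l : 0 < s l by rewrite /s !mulr_gt0 // ?exprn_gt0.
have /choice[U UP] l := ctl _ (s0 l).
pose U' l a := U l (inord a : 'I_m.+1).
apply: (HD I (meets S F) (meets_cell S F q U' bl Lm) (hull_lev S F q bl Lm) Lm).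
- exact: meets_adj.
- by move=> x _; exact: max_lev_le.
- move=> i ii; have [_ _ [x [Six _]]] := ii.
  have [cov _ _] := UP (hull_lev S F q bl Lm i).
  have : (\bigcup_i0 \bigcup_(A in U (hull_lev S F q bl Lm i) i0) A) x by rewrite cov.
  move=> [a _ [A UA Ax]]; exists a => //; exists A, x; split=> //.
    by rewrite /U' inord_val.
  by exists i => //; exact: walkxx.
- move=> a am; apply: (hull_tree_like hd c0 eps0).
  + move=> i x y Fi; apply: diam_within; exact: (blP i).1.
  + exact: LmP.
  + move=> l b A x y UA; apply: diam_within.
    by have [_ small _] := UP l.+1; exact: small UA.
  + move=> l b A B x y UA UB Ax By; apply: (r_disjoint_within _ UA UB Ax By).
    by have [_ _ disj] := UP l.+1; exact: disj.
  + move=> l x.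
    have ratio : 2 * (tau * scale c eps l.+2) / (eps * lam ^+ l) = 2 * tau * lam ^+ 2.
      rewrite /scale -/lam exprS exprS; field.
      by rewrite expf_neq0 ?gt_eqF.
    have fK : f (2 * (tau * scale c eps l.+2) / (eps * lam ^+ l)) < K.+1%:R.
      by rewrite ratio; exact: truncnS_gt.
    have r0 : 0 < 2 * (tau * scale c eps l.+2).
      by do 3![apply: mulr_gt0 => //]; exact: exprn_gt0.
    have e0 : 0 < eps * lam ^+ l by rewrite mulr_gt0 // exprn_gt0.
    apply: thin_sub (@space_filling_thin _ _ _ _ _ _ F _ _ _ x fill r0 e0 fK).
    move=> i [Fi lbl xy].
    (* For [l = 0] the lower bound comes from the gap [eps], since [scale] vanishes there. *)
    split=> //; case: l lbl {ratio fK r0 e0 xy} => [|l] lbl.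
      by rewrite expr0 mulr1; apply: gap => //; exact: (blP i).2 0%N lbl.
    by apply: ltW; exact: (blP i).2 l.+1 lbl.
Qed.

(** * Infinite families *)

(* The colourings of the finite subfamilies have a limit along an ultrafilter
   of finite sets; a monochromatic chain of the limit is monochromatic in some
   finite subfamily. *)
Lemma coloring_compactness (X I : Type) (S : I -> set X) (n r D : nat) :
    (forall F : set I, finite_set F -> exists col : I -> nat,
      (forall v, (col v <= n)%N) /\
      forall i, chains_bounded (meets S F) (walk (meets S F) r)
        (fun v => col v = i) D) ->
  exists col : I -> nat, (forall v, (col v <= n)%N) /\
    forall i, chains_bounded (meets S setT) (walk (meets S setT) r)
      (fun v => col v = i) D.
Proof.
move=> fin.
have /choice[cF cFP] (F : set I) : exists col : I -> nat,
    (forall v, (col v <= n)%N) /\ (finite_set F ->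
      forall i, chains_bounded (meets S F) (walk (meets S F) r)
        (fun v => col v = i) D).
  have [/fin[col [cn cb]]|nF] := pselect (finite_set F); first by exists col.
  by exists (fun=> 0%N); split.
pose B (A : set I) : set (set I) := [set F | finite_set F /\ A `<=` F].
have PB : ProperFilter (filter_from finite_set B).
  apply: filter_from_proper => [|A fA]; last by exists A; split.
  apply: filter_from_filter => [|A A' fA fA']; first by exists set0.
  exists (A `|` A'); first by rewrite finite_setU.
  by move=> F [fF AF]; split; split=> // x Ax; apply: AF; [left|right].
have [G [uG BG]] := ultraFilterLemma PB.
have pG : ProperFilter G by case: uG.
have G1 v : G [set F | F v].
  apply: BG; exists [set v]; first exact: finite_set1.
  by move=> F [_]; apply.
have Gfin : G [set F | finite_set F].
  by apply: BG; exists set0 => // F [].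
(* If no colour class of [v] were in [G], finitely many complements would meet in a set of [G] on
   which [v] has no colour. *)
have /choice[col colP] v : exists i, (i <= n)%N /\ G [set F | cF F v = i].
  apply: contrapT => no.
  have Gn k : (k <= n.+1)%N -> G [set F | forall i, (i < k)%N -> cF F v <> i].
    elim: k => [_|k IH kn]; first by apply: filterS filterT => F _ i.
    have [Gk|Gk] := in_ultra_setVsetC [set F | cF F v = k] uG.
      by case: no; exists k.
    apply: filterS (filterI (IH (ltnW kn)) Gk) => F [Fk nk] i.
    by rewrite ltnS leq_eqVlt => /predU1P[->|/Fk].
  have [F /(_ (cF F v))] := filter_ex (Gn _ (leqnn _)).
  by rewrite ltnS (cFP F).1 => /(_ isT).
exists col; split=> [v|i x y xy]; first by case: (colP v).
have Gwalk k a b : walk (meets S setT) k a b -> G [set F | walk (meets S F) k a b].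
  elim: k b => [b [<- [_ _ aa]]|k IH b [z /IH az [_ _ zb]]].
    by apply: filterS (G1 a) => F Fa.
  apply: filterS (filterI az (filterI (G1 z) (G1 b))) => F [wz [Fz Fb]].
  by exists z.
have Gchain : G [set F | chain (fun v => cF F v = i) (walk (meets S F) r) x y].
  elim: xy => [cx /Gwalk xx|z z' _ IH /Gwalk zz' cz'].
    apply: filterS (filterI xx (colP x).2) => F [Fxx cFx].
    by apply: chain0 => //; rewrite cFx.
  apply: filterS (filterI IH (filterI zz' (colP z').2)) => F [Fz [Fzz' cFz]].
  by apply: (chainS Fz Fzz'); rewrite cFz.
have [F [fF Fxy]] := filter_ex (filterI Gfin Gchain).
by apply: walk_sub ((cFP F).2 fF i x y Fxy) => a b [].
Qed.

(** * Intersection graphs *)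

Section GraphDistance.
Variables (R : realType) (X I : Type) (S : I -> set X).

Local Notation e := (meets S setT).
Local Notation G := (intersection_graph S).

(** An empty member has no loop in [meets], so the path of length [0] is excluded. *)
Lemma path_walk k (x y : I) (p : nat -> I) :
  (0 < k)%N -> @is_path G x y k p -> walk e k x y.
Proof.
move=> k0 [p0 pk padj _].
have step i : (i < k)%N -> e (p i) (p i.+1).
  by move=> /padj[_ [z [? ?]]]; split=> //; exists z.
have ee : e x x by rewrite -p0; exact: adjl (meets_adj S setT) _ _ (step 0%N k0).
rewrite -pk; elim: k {k0 pk padj} step => [_|k IH step]; first by rewrite p0; split.
by exists (p k); [apply: IH => i ik; apply: step; exact: ltnW|exact: step].
Qed.

(** Loops are cut: if [y] is already on the path, the path is truncated there. *)
Lemma walk_path k (x y : I) : walk e k x y ->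
  exists2 j, (j <= k)%N & exists p, @is_path G x y j p.
Proof.
elim: k y => [y [<- _]|k IH y [z /IH[j jk [p [p0 pj padj pinj]]] [_ _ zy]]].
  exists 0%N => //; exists (fun=> x); split=> // i j.
  by rewrite !leqn0 => /eqP-> /eqP->.
have [[i ij piy]|nop] := pselect (exists2 i, (i <= j)%N & p i = y).
  exists i; first by rewrite (leq_trans ij) // leqW.
  exists p; split=> // [a ai|a b ai bi]; first by apply: padj; exact: leq_trans ij.
  by apply: pinj; exact: leq_trans ij.
exists j.+1; first by rewrite ltnS.
exists (fun i => if (i <= j)%N then p i else y); split.
- exact: p0.
- by rewrite ltnn.
- move=> i; rewrite ltnS leq_eqVlt => /predU1P[->|ij].
    rewrite eqxx ltnn /= pj; split=> // ezy; apply: nop; exists j => //.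
    by rewrite pj.
  by rewrite ij orbT; exact: padj.
- move=> a b; rewrite leq_eqVlt ltnS => /predU1P aj.
  rewrite leq_eqVlt ltnS => /predU1P bj; case: aj bj => [->|aj] [->|bj] //.
  + by rewrite ltnn bj => e; case: nop; exists b.
  + by rewrite ltnn aj => e; case: nop; exists a.
  + by rewrite aj bj; exact: pinj.
Qed.

Lemma walk_dist k (x y : I) :
  walk e k x y -> (@graph_dist R G x y <= (k%:R)%:E)%E.
Proof.
move=> /walk_path[j jk jp]; apply: (@le_trans _ _ (j%:R)%:E).
  by apply: ereal_inf_lbound; exists j.
by rewrite lee_fin ler_nat.
Qed.

Lemma graph_distxx (x : I) : (@graph_dist R G x x <= 0%:E)%E.
Proof.
apply: ereal_inf_lbound; exists 0%N => //; exists (fun=> x); split=> // i j.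
by rewrite !leqn0 => /eqP-> /eqP->.
Qed.

Lemma coloring_control (n k D : nat) (r : R) (col : I -> nat) :
    r < k.+1%:R -> (forall v, (col v <= n)%N) ->
    (forall i, chains_bounded e (walk e k) (fun v => col v = i) D) ->
  exists U : 'I_n.+1 -> set (set (vertex G)),
    [/\ \bigcup_i \bigcup_(A in U i) A = setT,
        forall i A, U i A -> (diam (@graph_dist R G) A <= (D%:R)%:E)%E
      & forall i, r_disjoint (@graph_dist R G) r (U i)].
Proof.
move=> rk coln colD; have ae := meets_adj S setT.
have aw := walk_adj ae k.
(* The case [y = x] gives empty members, which lie on no chain, singleton classes. *)
pose rel i x y := y = x \/ chain (fun v => col v = i) (walk e k) x y.
have relC i x y : rel i x y -> rel i y x.
  by move=> [->|/(chainC aw)]; [left|right].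
have rel_trans i x y z : rel i x y -> rel i y z -> rel i x z.
  move=> [->//|xy] [->|yz]; [by right|right; exact: chain_trans xy yz].
have rel_col i x y : col x = i -> rel i x y -> col y = i.
  by move=> cx [->//|xy]; exact: chainr xy.
exists (fun i A => exists2 x, col x = i & A = [set y | rel i x y]); split.
- apply/seteqP; split=> // x _; exists (inord (col x)) => //.
  exists [set y | rel (col x) x y]; last by left.
  by exists x; rewrite inordK // ltnS.
- move=> i _ [x cx ->]; rewrite /diam ge_max lee_fin ler0n /=.
  apply: ge_ereal_sup => _ [y xy [z xz <-]].
  have [->|yz] := rel_trans _ _ _ _ (relC _ _ _ xy) xz.
    by apply: le_trans (graph_distxx y) _; rewrite lee_fin.
  by apply: walk_dist; exact: colD yz.
- move=> i _ _ [x cx ->] [x' cx' ->] neq.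
  apply: (@lt_le_trans _ _ (k.+1%:R)%:E); first by rewrite lte_fin.
  apply: le_ereal_inf_tmp => _ [y xy [y' xy' <-]].
  (* A path with at most [k] edges would merge the two classes, so its length is at least [k.+1]. *)
  apply: le_ereal_inf_tmp => _ [j [p pj] <-]; rewrite lee_fin ler_nat ltnNge.
  apply/negP => jk; apply: neq.
  have yy' : rel i y y'.
    case: j pj jk => [[p0 <- _ _] _|j pj jk]; first by left; rewrite p0.
    have w := walkW ae jk (path_walk (ltn0Sn j) pj).
    right; apply: (chainS _ w (rel_col _ _ _ cx' xy')).
    by apply: chain0 (rel_col _ _ _ cx xy) _; exact: adjl w.
  have xx' : rel i x x' := rel_trans _ _ _ _ (rel_trans _ _ _ _ xy yy') (relC _ _ _ xy').
  apply/seteqP; split=> z /= xz; first exact: rel_trans (relC _ _ _ xx') xz.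
  exact: rel_trans xx' xz.
Qed.

End GraphDistance.

Theorem theorem1p3 (R : realType) (n : nat) (f : R -> R)
    (X : Type) (d : X -> X -> \bar R)
    (hn : (0 < n)%N) (hf : nonneg_fun f) (hd : extended_metric d)
    (hdim : (assouad_nagata_dim d <= (n%:R)%:E)%E) :
  (asdim R (space_filling_graphs d f) <= ((n.+1)%:R)%:E)%E.
Proof.
(* The strict bound extracts from the infimum an attained dimension [m < n.+1]. *)
have dimn : (assouad_nagata_dim d < (n.+1%:R)%:E)%E.
  by apply: le_lt_trans hdim _; rewrite lte_fin ltr_nat.
have [_ [m [g [c c0 gc] ctl] <-] mn] := ereal_inf_lt dimn.
rewrite gc in ctl.
apply: (@le_trans _ _ (m.+1%:R)%:E); last first.
  by move: mn; rewrite lte_fin lee_fin ltr_nat ler_nat.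
apply: ereal_inf_lbound; exists m.+1 => //.
have /choice[D DP] k := finite_coloring k f hd c0 ctl.
exists (fun r => (D (Num.truncn r))%:R) => _ [I [S [fill ->]]].
split=> [x _|r r0]; first exact: ler0n.
have [col [coln colD]] := coloring_compactness (fun F => DP (Num.truncn r) I S F fill).
exact: coloring_control (truncnS_gt r) coln colD.
Qed.
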